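(* Let $\alpha>-2$ and $T>0$. There is no vector field $B\in C([0,T);C^2(\mathbb R^3,\mathbb R^3))$ that is a classical solution on $\mathbb R^3\times[0,T)$ of $$B_t+\nabla\times((\nabla\times B)\times B)=0,\qquad \nabla\cdot B=0,$$ and that has the self-similar form $$B(x,t)=\frac{1}{(T-t)^{\frac{\alpha}{\alpha+2}}}\,H\!\left(\frac{x}{(T-t)^{\frac{1}{\alpha+2}}}\right),\qquad x\in\mathbb R^3,\ t\in[0,T),$$ for some profile vector field $H:\mathbb R^3\to\mathbb R^3$, and for which both of the following conditions hold: (i) with $J=\nabla\times B$, the trajectory mapping $X(\cdot,t)$ generated by $-J$ is a $C^1$ diffeomorphism for every $t\in(0,T)$; (ii) $H\not\equiv 0$ and there exists $p_0>0$ such that $H\in L^p(\mathbb R^3)$ for all $p\in(0,p_0)$.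
   Context: The system $B_t+\nabla\times((\nabla\times B)\times B)=0$, $\nabla\cdot B=0$ is the electron MHD system with zero resistivity; $J=\nabla\times B$ is the current density. The trajectory mapping generated by $-J$ is the map $X(a,t)$ solving $\partial_t X(a,t)=-J(X(a,t),t)$, $X(a,0)=a$, for $a\in\mathbb R^3$. For $0<p<1$, $H\in L^p(\mathbb R^3)$ means $\int_{\mathbb R^3}|H|^p\,dx<\infty$. The space $C^2(\mathbb R^3,\mathbb R^3)$ carries the norm given by the supremum over $\mathbb R^3$ of the derivatives up to order 2, so that for $B\in C([0,T);C^2)$ the quantity $\|\nabla J(t)\|_{L^\infty}$ is finite and locally bounded in $t\in[0,T)$. *)

(* Defs.v *)
From HB Require Import structures.
From mathcomp Require Import all_boot all_order all_algebra.
From mathcomp Require Import all_classical all_reals all_analysis.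

Set Implicit Arguments.
Unset Strict Implicit.
Unset Printing Implicit Defensive.

Import Order.TTheory GRing.Theory Num.Theory.
Import numFieldNormedType.Exports.

Local Open Scope classical_set_scope.
Local Open Scope ring_scope.

Section VectorCalculus.
Context {R : realType}.
Implicit Types (F : 'rV[R]_3 -> 'rV[R]_3) (x u v : 'rV[R]_3).

Definition vec3 (a b c : R) : 'rV[R]_3 := \row_(i < 3) [:: a; b; c]`_i.

(* The library's norm on 'rV[R]_3 is the sup norm. *)
Definition enorm v : R := Num.sqrt (\sum_(i < 3) v 0 i ^+ 2).

Definition cross u v : 'rV[R]_3 :=
  vec3 (u 0 1 * v 0 2 - u 0 2 * v 0 1)
       (u 0 2 * v 0 0 - u 0 0 * v 0 2)
       (u 0 0 * v 0 1 - u 0 1 * v 0 0).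

Definition partial (i : 'I_3) F : 'rV[R]_3 -> 'rV[R]_3 :=
  fun x => 'D_(delta_mx 0 i) F x.

Definition curl F : 'rV[R]_3 -> 'rV[R]_3 := fun x =>
  vec3 (partial 1 F x 0 2 - partial 2 F x 0 1)
       (partial 2 F x 0 0 - partial 0 F x 0 2)
       (partial 0 F x 0 1 - partial 1 F x 0 0).

Definition divergence F : 'rV[R]_3 -> R :=
  fun x => \sum_(i < 3) partial i F x 0 i.

Definition iter_partial (s : seq 'I_3) F : 'rV[R]_3 -> 'rV[R]_3 :=
  foldr partial F s.

(* Since 'D_v is total, existence of the partial derivatives of order <= k is
   required separately from their continuity. *)
Definition Ck (k : nat) F : Prop :=
  (forall (s : seq 'I_3) (i : 'I_3) x, (size s < k)%N ->
     derivable (iter_partial s F) x (delta_mx 0 i)) /\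
  (forall s : seq 'I_3, (size s <= k)%N -> continuous (iter_partial s F)).

Definition Ck_norm (k : nat) F : \bar R :=
  ereal_sup [set y | exists (s : seq 'I_3) x,
    (size s <= k)%N /\ y = (enorm (iter_partial s F x))%:E].

(* The normed space C^k(R^3, R^3): all derivatives up to order k bounded. *)
Definition Ck_bounded (k : nat) F : Prop :=
  Ck k F /\ (Ck_norm k F < +oo)%E.

Definition C1_diffeo F : Prop :=
  exists G, [/\ cancel F G, cancel G F, Ck 1 F & Ck 1 G].

(* H \in L^p(R^3), for 0 < p; R^3 carries the threefold product of the
   Lebesgue measure on R. *)
Definition mem_Lp (p : R) (H : 'rV[R]_3 -> 'rV[R]_3) : Prop :=
  let h := fun z : (R * R) * R => H (vec3 z.1.1 z.1.2 z.2) in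
  (forall i : 'I_3, measurable_fun setT (fun z => h z 0 i)) /\
  (\int[(lebesgue_measure \x lebesgue_measure) \x lebesgue_measure]_(z in setT)
      (enorm (h z) `^ p)%:E < +oo)%E.

End VectorCalculus.

Section ElectronMHD.
Context {R : realType}.
Implicit Types (T alpha : R) (B : R -> 'rV[R]_3 -> 'rV[R]_3).

(* f'(t) = l, for the derivative of f relative to the time interval [0, T):
   two-sided for 0 < t < T, one-sided at t = 0. *)
Definition time_deriv T (f : R -> 'rV[R]_3) (t : R) (l : 'rV[R]_3) : Prop :=
  (s - t)^-1 *: (f s - f t) @[s --> within `[0, T[ t^'] --> l.

(* B \in C([0, T); C^2(R^3, R^3)) *)
Definition in_C_C2 T B : Prop :=
  (forall t, 0 <= t < T -> Ck_bounded 2 (B t)) /\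
  (forall t, 0 <= t < T ->
     Ck_norm 2 (B s \- B t) @[s --> within `[0, T[ (nbhs t)] --> 0%E).

Definition current B : R -> 'rV[R]_3 -> 'rV[R]_3 := fun t => curl (B t).

Definition emhd_solution T B : Prop :=
  forall t x, 0 <= t < T ->
    time_deriv T (B ^~ x) t
      (- curl (fun y => cross (current B t y) (B t y)) x) /\
    divergence (B t) x = 0.

Definition self_similar alpha T (H : 'rV[R]_3 -> 'rV[R]_3) B : Prop :=
  forall t x, 0 <= t < T ->
    B t x = ((T - t) `^ (alpha / (alpha + 2)))^-1 *:
            H (((T - t) `^ (1 / (alpha + 2)))^-1 *: x).

(* X t a is the position X(a, t). *)
Definition trajectory_map T (V : R -> 'rV[R]_3 -> 'rV[R]_3)
    (X : R -> 'rV[R]_3 -> 'rV[R]_3) : Prop :=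
  forall a, X 0 a = a /\
    forall t, 0 <= t < T -> time_deriv T (X ^~ a) t (V t (X t a)).

End ElectronMHD.

(* Main.v *)
Require Import Defs.
From HB Require Import structures.
From mathcomp Require Import all_boot all_order all_algebra.
From mathcomp Require Import all_classical all_reals all_analysis.
From mathcomp Require Import measurable_realfun ring lra.

(* Differentiating the self-similar form at a fixed time turns the equation
   into a stationary one for the profile: with K = curl H, lam = 1/(alpha+2),
   a = alpha lam and V(y) = lam y - K(y),
     (V . grad) H = - a H - (H . grad) K,    div V = 3 lam,
   the latter because mixed partial derivatives commute.  Since grad K is
   bounded, |V . grad |H|^2| <= C |H|^2, so for G = |H|^(2q) (regularized near
   the zeros of H) one has |V . grad G| <= 2 q C |H|^(2q).  Integrating
   div (chi G V) over a box, with a cutoff chi vanishing on the faces, and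
   letting the box fill the space gives
     3 lam \int |H|^(2q) <= 2 q C \int |H|^(2q),
   hence H = 0 once q is small. *)

Set Implicit Arguments.
Unset Strict Implicit.
Unset Printing Implicit Defensive.

Import Order.TTheory GRing.Theory Num.Theory.
Import numFieldNormedType.Exports.
Local Open Scope classical_set_scope.
Local Open Scope ring_scope.

(** The constant C depends on the bounds of H, so q cannot be fixed in advance: integrability is
    needed for arbitrarily small exponents, and for these |H|^(2q) is not differentiable at the
    zeros of H. Its substitute, with s = |H|^2, is (s + e)^q - e^q: it is differentiable, vanishes
    with s and never exceeds s^q, so one integrable function dominates all values of e. The field V
    grows linearly, so cutting off at distance r does not make V . grad chi uniformly small. A
    gradient of size 1/r keeps this product bounded, and it tends to 0 pointwise; dominated
    convergence against |H|^(2q) then replaces a uniform estimate. The assumption alpha > -2 enters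
    as lam > 0. The profile inherits its global C^2 bounds from a single time slice of B. *)

Notation "''e_' i" := (delta_mx 0 i : 'rV_3) (at level 8, i at level 2).

(** * Coordinates of R^3 and derivatives along lines *)

Section Coordinates.
Context {R : realType}.
Implicit Types (x y v : 'rV[R]_3) (f : 'rV[R]_3 -> R).

Lemma forall_I3 (P : 'I_3 -> Prop) : P 0 -> P 1 -> P 2 -> forall i, P i.
Proof.
move=> P0 P1 P2 [[|[|[|//]]] hi].
- by rewrite (_ : Ordinal hi = 0) //; apply: val_inj.
- by rewrite (_ : Ordinal hi = 1) //; apply: val_inj.
- by rewrite (_ : Ordinal hi = 2) //; apply: val_inj.
Qed.

Lemma sum_I3 (F : 'I_3 -> R) : \sum_(i < 3) F i = F 0 + F 1 + F 2.
Proof.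
rewrite !big_ord_recl big_ord0 addr0 addrA.
by congr (F _ + F _ + F _); apply: val_inj.
Qed.

Lemma vec3E0 (a b c : R) : vec3 a b c 0 0 = a. Proof. by rewrite mxE. Qed.
Lemma vec3E1 (a b c : R) : vec3 a b c 0 1 = b. Proof. by rewrite mxE. Qed.
Lemma vec3E2 (a b c : R) : vec3 a b c 0 2 = c. Proof. by rewrite mxE. Qed.
Definition vec3E := (vec3E0, vec3E1, vec3E2).

Lemma row3P x y : x 0 0 = y 0 0 -> x 0 1 = y 0 1 -> x 0 2 = y 0 2 -> x = y.
Proof. by move=> h0 h1 h2; apply/rowP; apply: forall_I3. Qed.

Lemma cvg_row3 (T : Type) (F : set_system T) {FF : Filter F}
    (g : T -> 'rV[R]_3) (l : 'rV[R]_3) :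
  (forall i, g t 0 i @[t --> F] --> l 0 i) -> g @ F --> l.
Proof.
move=> gl; apply/cvgrPdist_le => /= e e0; near=> t.
rewrite [leLHS]/Num.Def.normr/= mx_normrE (bigmax_le _ (ltW e0))//= => i _.
rewrite !mxE/= (ord1 i.1).
move: i; near: t; apply: filter_forall => /= i.
exact: ((cvgrPdist_le _ _).1 (gl i.2)).
Unshelve. all: by end_near. Qed.

Lemma cvg_vec3 (T : Type) (F : set_system T) {FF : Filter F}
    (a b c : T -> R) (a0 b0 c0 : R) :
  a @ F --> a0 -> b @ F --> b0 -> c @ F --> c0 ->
  vec3 (a t) (b t) (c t) @[t --> F] --> vec3 a0 b0 c0.
Proof.
move=> ha hb hc; apply: cvg_row3; apply: forall_I3; rewrite !vec3E.
- by under eq_fun do rewrite vec3E.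
- by under eq_fun do rewrite vec3E.
- by under eq_fun do rewrite vec3E.
Qed.

Lemma coord_e i j : ('e_i : 'rV[R]_3) 0 j = (i == j)%:R.
Proof. by rewrite mxE eqxx eq_sym. Qed.

(** Both difference quotients are the same function of the increment. This is the bridge from
    directional derivatives to one-variable calculus: chain rule, mean value theorem, fundamental
    theorem. *)
Lemma is_derive_line f (x v : 'rV[R]_3) (t d : R) :
  is_derive (t *: v + x) v f d <-> is_derive t 1 (fun s => f (s *: v + x)) d.
Proof.
have E : (fun h => h^-1 *: ((f \o shift (t *: v + x)) (h *: v) - f (t *: v + x)))
    = (fun h => h^-1 *: (((fun s => f (s *: v + x)) \o shift t) (h *: 1)
                         - f (t *: v + x))).
  apply/funext => h /=; congr (_ *: (f _ - _)).
  by rewrite /= [h *: 1]mulr1 scalerDl addrA.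
split=> -[h1 h2]; split.
- by move: h1; rewrite /derivable E.
- by rewrite -h2 /derive E.
- by move: h1; rewrite /derivable E.
- by rewrite -h2 /derive E.
Qed.

Lemma is_derive_line0 f (x v : 'rV[R]_3) (d : R) :
  is_derive x v f d <-> is_derive (0 : R) 1 (fun s => f (s *: v + x)) d.
Proof. by rewrite -is_derive_line scale0r add0r. Qed.

Lemma continuous_coord i : continuous (fun x : 'rV[R]_3 => x 0 i).
Proof. exact: coord_continuous. Qed.

Lemma is_derive_coord i x v : is_derive x v (fun y => y 0 i) (v 0 i).
Proof.
have h : is_derive x v id v by exact: is_derive_id.
have [h1 h2] := h.
split; first by move/derivable_mxP: h1.
move: h2; rewrite derive_mx // => /rowP /(_ i).
by rewrite mxE.
Qed.

End Coordinates.

(** * Measurability of continuous functions on the triple product *)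

Section Measurability.
Context {R : realType}.
Local Notation RB := (measurableTypeR R).

Let gr (n : nat) (x : R) : R := (Num.floor (n.+1%:R * x))%:~R / n.+1%:R.

Let gr_cvg (x : R) : gr ^~ x @ \oo --> x.
Proof.
apply/cvgrPdist_le => e e0; near=> n.
have n0 : 0 < n.+1%:R :> R by [].
have /andP[h1 h2] := floor_itv (n.+1%:R * x).
rewrite /gr.
have -> : x - (Num.floor (n.+1%:R * x))%:~R / n.+1%:R
    = (n.+1%:R * x - (Num.floor (n.+1%:R * x))%:~R) / n.+1%:R.
  by rewrite mulrBl [n.+1%:R * x]mulrC mulfK ?pnatr_eq0.
have -> : `|(n.+1%:R * x - (Num.floor (n.+1%:R * x))%:~R) / n.+1%:R|
  = (n.+1%:R * x - (Num.floor (n.+1%:R * x))%:~R) / n.+1%:R.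
  by apply: ger0_norm; rewrite divr_ge0 // subr_ge0.
apply: (@le_trans _ _ (n.+1%:R^-1)).
  rewrite ler_pdivrMr // mulVf ?pnatr_eq0 //.
  move: h2; rewrite intrD; lra.
near: n.
have := near_infty_natSinv_lt (PosNum e0).
by apply: filterS => n /ltW.
Unshelve. all: by end_near. Qed.

Let gr_measurable n (k : int) :
  measurable ([set x : R | Num.floor (n.+1%:R * x) = k] : set RB).
Proof.
have n0 : 0 < n.+1%:R :> R by [].
rewrite (_ : [set _ | _] = `[k%:~R / n.+1%:R, (k + 1)%:~R / n.+1%:R[%classic).
  exact: measurable_itv.
apply/seteqP; split => x /=; rewrite in_itv /= ler_pdivrMr // ltr_pdivlMr //
    [x * _]mulrC.
  by move=> <-; apply: floor_itv.
by move=> h; apply: floor_def.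
Qed.

Let cell n (k : int * int * int) := [set z : (RB * RB) * RB |
  [/\ Num.floor (n.+1%:R * z.1.1) = k.1.1, Num.floor (n.+1%:R * z.1.2) = k.1.2
    & Num.floor (n.+1%:R * z.2) = k.2]].

Let cell_measurable n k : measurable (cell n k).
Proof.
rewrite (_ : cell n k =
   ([set x : R | Num.floor (n.+1%:R * x) = k.1.1] `*`
    [set x : R | Num.floor (n.+1%:R * x) = k.1.2]) `*`
    [set x : R | Num.floor (n.+1%:R * x) = k.2]).
  by apply: measurableX; [apply: measurableX|].
by apply/seteqP; split => z /=; [case=> ? ? ?|case=> -[? ?] ?].
Qed.

(* [f] is the pointwise limit of its samplings on the lattices Z^3/(n+1),
   which take countably many values. *)
Lemma continuous_measurable_vec3 (f : 'rV[R]_3 -> R) : continuous f ->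
  measurable_fun setT (fun z : (RB * RB) * RB => f (vec3 z.1.1 z.1.2 z.2)).
Proof.
move=> cf.
pose F n (z : (RB * RB) * RB) := f (vec3 (gr n z.1.1) (gr n z.1.2) (gr n z.2)).
apply: (@measurable_fun_cvg _ _ _ _ F) => [n _ Y mY|z _]; last first.
  apply: (continuous_cvg _ (cf _)).
  by apply: cvg_vec3; exact: gr_cvg.
rewrite setTI.
pose v (k : int * int * int) := f (vec3 (k.1.1%:~R / n.+1%:R)
   (k.1.2%:~R / n.+1%:R) (k.2%:~R / n.+1%:R)).
(* The sampled function is constant on each [cell n k], so its preimages are countable unions of
   cells. *)
rewrite (_ : _ @^-1` _ =
    \bigcup_k (if v k \in Y then cell n k else set0)).
  apply: countable_bigcupT_measurable; first exact: countableP.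
  by move=> k; case: ifP => _.
apply/seteqP; split => z /=.
  move=> Yz; exists (Num.floor (n.+1%:R * z.1.1), Num.floor (n.+1%:R * z.1.2),
    Num.floor (n.+1%:R * z.2)) => //.
  by rewrite ifT // inE.
case=> k _; case: ifPn => // /[!inE] Yk [h1 h2 h3].
by rewrite /F /gr h1 h2 h3.
Qed.

End Measurability.

(** * The divergence theorem on a cube, for fields vanishing on the faces *)

Section BoxDivergence.
Context {R : realType}.
Local Notation RB := (measurableTypeR R).
Local Notation leb := (@lebesgue_measure R).
Implicit Types (r : R) (u du : 'rV[R]_3 -> R).

Definition seg r : set RB := `[- r, r]%classic.

Lemma measurable_seg r : measurable (seg r).
Proof. exact: measurable_itv. Qed.

Lemma leb_seg r : (leb (seg r) < +oo)%E.
Proof.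
by rewrite /seg lebesgue_measure_itv; case: ifP => // _; rewrite -EFinB ltry.
Qed.

(* The library's canonical sigma-finite structure on [_ \x _] only covers
   subprobabilities; a named constant carries the missing instance. *)
Definition leb2 := (leb \x leb)%E.

Lemma leb2_seg r : (leb2 (seg r `*` seg r) < +oo)%E.
Proof.
have mI := measurable_seg r.
by rewrite /leb2 product_measure1E ?lte_mul_pinfty ?ge0_fin_numE ?leb_seg.
Qed.

Lemma sigma_finite_leb2 : sigma_finite setT leb2.
Proof.
exists (fun n => seg n%:R `*` seg n%:R) => [|n].
  apply/seteqP; split => // -[x y] _ /=.
  pose m := maxn (Num.bound `|x|) (Num.bound `|y|).
  exists m => //; split => /=; rewrite /seg /= in_itv /= -ler_norml ltW //.
    by rewrite (lt_le_trans (archi_boundP _)) // ler_nat leq_maxl.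
  by rewrite (lt_le_trans (archi_boundP _)) // ler_nat leq_maxr.
by split; [apply: measurableX; exact: measurable_seg|exact: leb2_seg].
Qed.

HB.instance Definition _ := Measure.on leb2.
HB.instance Definition _ :=
  Measure_isSigmaFinite.Build _ _ _ leb2 sigma_finite_leb2.

Local Notation leb3 := (leb2 \x leb)%E.

Definition box r : set ((RB * RB) * RB) := (seg r `*` seg r) `*` seg r.
Definition pt (z : (RB * RB) * RB) : 'rV[R]_3 := vec3 z.1.1 z.1.2 z.2.

Lemma measurable_box r : measurable (box r).
Proof. by do ?apply: measurableX; exact: measurable_seg. Qed.

Lemma leb_box r : (leb3 (box r) < +oo)%E.
Proof.
have mI := measurable_seg r.
have mI2 : measurable (seg r `*` seg r) by exact: measurableX.
by rewrite product_measure1E ?lte_mul_pinfty ?ge0_fin_numE ?leb_seg ?leb2_seg.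
Qed.

Lemma box_bounded r (f : 'rV[R]_3 -> R) : continuous f ->
  exists M, forall z, box r z -> `|f (pt z)| <= M.
Proof.
move=> cf.
pose A := [set v : 'rV[R]_3 | forall i, seg r (v ord0 i)].
have cA : compact A by apply: (@rV_compact _ _ (fun=> seg r)) => _; exact: segment_compact.
have : compact (f @` A).
  by apply: continuous_compact => //; exact: continuous_subspaceT.
move/compact_bounded => [M [_ hM]].
(* Boundedness supplies a bound only for numbers strictly above [M]. *)
exists (M + 1) => z [[z1 z2] z3]; apply: (hM (M + 1)); first by rewrite ltrDl.
exists (pt z) => //; rewrite /A /= -[ord0]/(0 : 'I_1).
by apply: forall_I3; rewrite vec3E.
Qed.

Lemma box_integrable r (f : 'rV[R]_3 -> R) : continuous f ->
  leb3.-integrable (box r) (fun z => (f (pt z))%:E).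
Proof.
move=> cf; have [M hM] := box_bounded r cf.
apply: (@measurable_bounded_integrable _ _ _ leb3 (fun z => f (pt z))).
- exact: measurable_box.
- exact: leb_box.
- by apply: measurable_funTS; exact: continuous_measurable_vec3.
- exists `|M|; split => [//|N MN z Dz /=].
  by rewrite (le_trans (hM z Dz)) // (le_trans (ler_norm _)) // ltW.
Qed.

Lemma integral_seg_derive0 r (f df : R -> R) : 0 < r -> continuous df ->
  (forall t : R, is_derive t 1 f (df t)) -> f (- r) = 0 -> f r = 0 ->
  (\int[leb]_t ((EFin \o df) \_ (seg r)) t = 0)%E.
Proof.
move=> r0 cdf hf fNr fr.
have cf : continuous f.
  move=> t; apply: differentiable_continuous; apply/derivable1_diffP.
  by have [] := hf t.
rewrite -integral_mkcond (@continuous_FTC2 _ df f) ?gtrN //.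
- by rewrite fNr fr subee.
- exact: continuous_subspaceT.
- split => [t _| |]; first by have [] := hf t.
  + exact/cvg_at_right_filter/cf.
  + exact/cvg_at_left_filter/cf.
- by move=> t _; rewrite derive1E; have [] := hf t.
Qed.

Lemma continuous_line (f : 'rV[R]_3 -> R) (x v : 'rV[R]_3) :
  continuous f -> continuous (fun t : R => f (t *: v + x)).
Proof.
move=> cf t; apply: (continuous_cvg _ (cf _)).
by apply: cvgD; [apply: cvgZr_tmp|apply: cvg_cst].
Qed.

(** Since [x 0 i = 0], the parameter [t] is itself the [i]-th coordinate, and the ends of the
    segment lie on the two faces where [u] vanishes. *)
Lemma integral_line0 r i u du (x : 'rV[R]_3) : 0 < r -> continuous du ->
  (forall y, is_derive y 'e_i u (du y)) ->
  (forall y : 'rV[R]_3, `|y 0 i| = r -> u y = 0) -> x 0 i = 0 ->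
  (\int[leb]_t ((fun t => (du (t *: 'e_i + x))%:E) \_ (seg r)) t = 0)%E.
Proof.
move=> r0 cdu hu u0 xi0.
apply: (@integral_seg_derive0 r (fun t => u (t *: 'e_i + x))) => //.
- exact: continuous_line.
- by move=> t; apply/is_derive_line.
- by apply: u0; rewrite !mxE xi0 !eqxx mulr1 addr0 normrN gtr0_norm.
- by apply: u0; rewrite !mxE xi0 !eqxx mulr1 addr0 gtr0_norm.
Qed.

Lemma restrict_box r (f : 'rV[R]_3 -> R) x y z :
  ((fun z => (f (pt z))%:E) \_ (box r)) (x, y, z) =
  if [&& x \in seg r, y \in seg r & z \in seg r] then (f (vec3 x y z))%:E else 0%E.
Proof.
rewrite patchE /pt /=; congr (if _ then _ else _).
apply/idP/idP => [|/and3P[]]; rewrite !inE.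
  by move=> -[[? ?] ?]; apply/and3P; rewrite !inE.
by move=> ? ? ?; split => //; split.
Qed.

(** By Fubini the [i]-th variable can be integrated innermost, where [integral_line0] gives 0. *)
Lemma box_divergence0 r i u du : 0 < r -> continuous du ->
  (forall y, is_derive y 'e_i u (du y)) ->
  (forall y : 'rV[R]_3, `|y 0 i| = r -> u y = 0) ->
  (\int[leb3]_(z in box r) (du (pt z))%:E = 0)%E.
Proof.
move=> r0 cdu.
have mI := measurable_seg r.
have idu : leb3.-integrable setT ((fun z => (du (pt z))%:E) \_ (box r)).
  by apply/(integrable_mkcond _ (measurable_box r)).1; exact: box_integrable.
rewrite integral_mkcond.
(* For the first two coordinates Fubini is applied a second time, to the slice at fixed [z]; this
   needs integrability on every slice, not just almost every one. *)
have slice z : leb2.-integrable setT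
    (fun p => ((fun z => (du (pt z))%:E) \_ (box r)) (p, z)).
  have [zr|zr] := boolP (z \in seg r); last first.
    rewrite (_ : (fun _ => _) = cst 0%E); first exact: integrable0.
    by apply/funext => -[x y]; rewrite restrict_box (negbTE zr) !andbF.
  rewrite (_ : (fun _ => _) = (fun p => (du (pt (p, z)))%:E) \_ (seg r `*` seg r)).
    have mI2 : measurable (seg r `*` seg r) by exact: measurableX.
    apply/(integrable_mkcond _ mI2).1.
    have [M hM] := box_bounded r cdu.
    apply: (@measurable_bounded_integrable _ _ _ _ (fun p => du (pt (p, z)))).
    - exact: mI2.
    - exact: leb2_seg.
    - apply: measurable_funTS.
      apply: (measurableT_comp (continuous_measurable_vec3 cdu)).
      by apply: measurable_fun_pair => //; exact: measurable_cst.
    - exists `|M|; split => [//|N MN p Dp /=].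
      rewrite (le_trans (hM _ _)) //; last by rewrite (le_trans (ler_norm _)) // ltW.
      by split => //=; rewrite -inE.
  apply/funext => -[x y]; rewrite restrict_box zr andbT patchE.
  congr (if _ then _ else _).
  apply/idP/idP => [/andP[]|]; rewrite !inE; first by move=> ? ?; split.
  by move=> -[? ?]; apply/andP; rewrite !inE.
move: i; apply: forall_I3 => hu u0.
- rewrite -(integral21_prod_meas1 idu); apply: integral0_eq => z _.
  rewrite /fubini_G -(integral21_prod_meas1 (slice z)); apply: integral0_eq => y _.
  rewrite /fubini_G.
  have [yz|yz] := boolP ((y \in seg r) && (z \in seg r)); last first.
    by apply: integral0_eq => x _; rewrite restrict_box (negbTE yz) andbF.
  rewrite -[RHS](@integral_line0 r 0 u du (vec3 0 y z)) ?vec3E //.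
  apply: eq_integral => x _; rewrite restrict_box patchE yz andbT.
  congr (if _ then _%:E else _); congr du.
  by apply: row3P; rewrite !mxE /= ?(mulr0, mulr1, addr0, add0r).
- rewrite -(integral21_prod_meas1 idu); apply: integral0_eq => z _.
  rewrite /fubini_G -(integral12_prod_meas1 (slice z)); apply: integral0_eq => x _.
  rewrite /fubini_F.
  have [xz|xz] := boolP ((x \in seg r) && (z \in seg r)); last first.
    by apply: integral0_eq => y _; rewrite restrict_box andbCA (negbTE xz) andbF.
  rewrite -[RHS](@integral_line0 r 1 u du (vec3 x 0 z)) ?vec3E //.
  apply: eq_integral => y _; rewrite restrict_box patchE andbCA xz andbT.
  congr (if _ then _%:E else _); congr du.
  by apply: row3P; rewrite !mxE /= ?(mulr0, mulr1, addr0, add0r).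
- rewrite -(integral12_prod_meas1 idu); apply: integral0_eq => -[x y] _.
  rewrite /fubini_F.
  have [xy|xy] := boolP ((x \in seg r) && (y \in seg r)); last first.
    by apply: integral0_eq => z _; rewrite restrict_box andbA (negbTE xy).
  rewrite -[RHS](@integral_line0 r 2 u du (vec3 x y 0)) ?vec3E //.
  apply: eq_integral => z _; rewrite restrict_box patchE andbA xy /=.
  congr (if _ then _%:E else _); congr du.
  by apply: row3P; rewrite !mxE /= ?(mulr0, mulr1, addr0, add0r).
Qed.

End BoxDivergence.

(** * Rules for directional derivatives and continuity *)

Section DirectionalCalculus.
Context {R : realType}.
Implicit Types (f g : 'rV[R]_3 -> R) (x v : 'rV[R]_3).

Lemma is_derive_sub f g x v (df dg : R) : is_derive x v f df ->
  is_derive x v g dg -> is_derive x v (fun y => f y - g y) (df - dg).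
Proof. by move=> hf hg; exact: is_deriveB. Qed.

Lemma is_derive_mul f g x v (df dg : R) : is_derive x v f df ->
  is_derive x v g dg ->
  is_derive x v (fun y => f y * g y) (df * g x + f x * dg).
Proof.
move=> hf hg; apply: (is_derive_eq (is_deriveM hf hg)).
by rewrite addrC [_ *: df]mulrC.
Qed.

Lemma is_derive_scale (k : R) f x v (df : R) : is_derive x v f df ->
  is_derive x v (fun y => k * f y) (k * df).
Proof.
move=> hf; apply: (is_derive_eq (is_derive_mul (is_derive_cst k x v) hf)).
by rewrite mul0r add0r.
Qed.

Lemma is_derive_comp1 (g : R -> R) f x v (df dg : R) : is_derive (f x) 1 g dg ->
  is_derive x v f df -> is_derive x v (fun y => g (f y)) (dg * df).
Proof.
move=> hg /is_derive_line0 hf; apply/is_derive_line0.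
by apply: is_derive1_comp; rewrite scale0r add0r.
Qed.

Lemma is_derive_sqr f x v (df : R) : is_derive x v f df ->
  is_derive x v (fun y => f y ^+ 2) (2 * (f x * df)).
Proof.
move=> hf; apply: (is_derive_eq (is_derive_mul hf hf)).
by rewrite mulrC; ring.
Qed.

Lemma is_derive_sum3 (f : 'I_3 -> 'rV[R]_3 -> R) x v (df : 'I_3 -> R) :
  (forall i, is_derive x v (f i) (df i)) ->
  is_derive x v (fun y => \sum_(i < 3) f i y) (\sum_(i < 3) df i).
Proof.
move=> hf; rewrite [X in is_derive _ _ X _](_ : _ = \sum_(i < 3) f i).
  exact: is_derive_sum.
by apply/funext => y; rewrite fct_sumE.
Qed.

Lemma is_derive_uniq f x v (d d' : R) :
  is_derive x v f d -> is_derive x v f d' -> d = d'.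
Proof. by move=> [_ <-] [_ <-]. Qed.

Lemma continuous_add f g : continuous f -> continuous g ->
  continuous (fun y => f y + g y).
Proof. by move=> cf cg y; exact: (cvgD (cf y) (cg y)). Qed.

Lemma continuous_sub f g : continuous f -> continuous g ->
  continuous (fun y => f y - g y).
Proof. by move=> cf cg y; exact: (cvgB (cf y) (cg y)). Qed.

Lemma continuous_mul f g : continuous f -> continuous g ->
  continuous (fun y => f y * g y).
Proof. by move=> cf cg y; exact: (cvgM (cf y) (cg y)). Qed.

Lemma continuous_sum3 (f : 'I_3 -> 'rV[R]_3 -> R) :
  (forall i, continuous (f i)) -> continuous (fun y => \sum_(i < 3) f i y).
Proof.
move=> cf; under eq_fun do rewrite sum_I3.
by do ?apply: continuous_add.
Qed.

Lemma continuous_cst3 (k : R) : continuous (fun _ : 'rV[R]_3 => k).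
Proof. exact: cst_continuous. Qed.

Lemma continuous_mulr f (k : R) : continuous f -> continuous (fun y => f y * k).
Proof. by move=> cf; exact: (continuous_mul cf (@continuous_cst3 k)). Qed.

Lemma continuous_mull (k : R) f : continuous f -> continuous (fun y => k * f y).
Proof. by move=> cf; exact: (continuous_mul (@continuous_cst3 k) cf). Qed.

End DirectionalCalculus.

(** * The regularized power *)

Section PowerRegularization.
Context {R : realType}.
Implicit Types (q e s : R).

(* Unlike [s `^ q], differentiable down to [s = 0]. *)
Definition regpow q e s : R := (s + e) `^ q - e `^ q.

Lemma regpow_ge0 q e s : 0 < q -> 0 < e -> 0 <= s -> 0 <= regpow q e s.
Proof.
move=> q0 e0 s0; rewrite subr_ge0; apply: ge0_ler_powR.
- exact: ltW.
- by rewrite nnegrE ltW.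
- by rewrite nnegrE addr_ge0 // ltW.
- by rewrite lerDr.
Qed.

(** The exponent q - 1 is nonpositive, so the power decreases when its base is shifted up. Up to the
    factor q, the left side is s times the derivative of [regpow], which is thus controlled
    uniformly in [e]. *)
Lemma mul_powR_shift_le q e s : 0 < q -> q <= 1 -> 0 < e -> 0 <= s ->
  s * (s + e) `^ (q - 1) <= s `^ q.
Proof.
move=> q0 q1 e0 s0; rewrite -[leRHS]mulr_powRB1 //.
(* At s = 0 the power with exponent q - 1 has only a conventional value, so powers are compared for
   s > 0 alone. *)
have [->|sn0] := eqVneq s 0; first by rewrite !mul0r.
have s1 : 0 < s by rewrite lt_def sn0.
apply: ler_wpM2l => //.
rewrite -[q - 1]opprB !powRN lef_pV2 ?posrE ?powR_gt0 ?addr_gt0 //.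
apply: ge0_ler_powR; first lra.
- by rewrite nnegrE.
- by rewrite nnegrE addr_ge0 // ltW.
- by rewrite lerDl ltW.
Qed.

(** Subadditivity of the power, from s (s+e)^(q-1) = (s+e)^q - e (s+e)^(q-1) >= (s+e)^q - e^q. *)
Lemma regpow_le q e s : 0 < q -> q <= 1 -> 0 < e -> 0 <= s ->
  regpow q e s <= s `^ q.
Proof.
move=> q0 q1 e0 s0.
apply: le_trans (mul_powR_shift_le q0 q1 e0 s0).
have se : 0 < s + e by exact: ltr_wpDl.
have -> : s * (s + e) `^ (q - 1) = (s + e) `^ q - e * (s + e) `^ (q - 1).
  by rewrite -[(s + e) `^ q]mulr_powRB1 ?(ltW se) //; ring.
rewrite lerB // -[leRHS](mulr_powRB1 (ltW e0) q0).
apply: ler_wpM2l; first exact: ltW.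
rewrite -[q - 1]opprB !powRN lef_pV2 ?posrE ?powR_gt0 //.
apply: ge0_ler_powR; first lra.
- by rewrite nnegrE ltW.
- by rewrite nnegrE ltW.
- by rewrite lerDr.
Qed.

Lemma is_derive_regpow q e s : 0 < s + e ->
  is_derive s 1 (regpow q e) (q * (s + e) `^ (q - 1)).
Proof.
move=> se.
have h : is_derive (s : R) 1 (fun t : R => t + e) 1.
  by apply: (is_derive_eq (is_deriveD (is_derive_id s 1) (is_derive_cst e s 1)));
    rewrite addr0.
have hp := @is_derive1_comp R (@powR R ^~ q) (fun t => t + e) s _ _
  (is_derive1_powR q se) h.
apply: (is_derive_eq (is_deriveB hp (is_derive_cst (e `^ q) s 1))).
by rewrite mulr1 subr0.
Qed.

Lemma regpow_cvg q s : 0 < q -> 0 <= s ->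
  regpow q (n.+1%:R^-1) s @[n --> \oo] --> s `^ q.
Proof.
move=> q0 s0.
have h : n.+1%:R^-1 @[n --> \oo] --> (0 : R).
  exact: cvg_harmonic.
have [->|sn0] := eqVneq s 0.
  rewrite powR0 ?gt_eqF //; apply: cvg_near_cst; apply: nearW => n.
  by rewrite /regpow add0r subrr.
have s1 : 0 < s by rewrite lt_def sn0.
rewrite -[s `^ q]subr0; apply: cvgB.
  have cp : {for s, continuous (fun t : R => t `^ q)}.
    apply: differentiable_continuous; apply/derivable1_diffP.
    by apply: derivable_powR; rewrite in_itv /= s1.
  apply: (continuous_cvg _ cp).
  by rewrite -[s in X in _ --> X]addr0; apply: cvgD => //; exact: cvg_cst.
apply/cvgrPdist_lt => d d0.
have /cvgrPdist_lt/(_ d d0)[r /= r0 hr] := powR_cvg0 q0.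
near=> n; apply: hr => /=; last by rewrite invr_gt0.
rewrite sub0r normrN ger0_norm ?invr_ge0 //; near: n.
exact: (near_infty_natSinv_lt (PosNum r0)).
Unshelve. all: by end_near. Qed.

End PowerRegularization.

(** * A polynomial cutoff on the cube *)

Section Cutoff.
Context {R : realType}.
Implicit Types (r : R) (y w : 'rV[R]_3).

Let c r (t : R) : R := 1 - (t / r) ^+ 2.
Let c' r (t : R) : R := - (2 * (t / r / r)).

(** A polynomial will do: integration is confined to the box, so only the values there and the zeros
    on the faces matter. *)
Definition cutoff r y : R := c r (y 0 0) * c r (y 0 1) * c r (y 0 2).

Definition dcutoff r y w : R :=
  (c' r (y 0 0) * w 0 0 * c r (y 0 1) + c r (y 0 0) * (c' r (y 0 1) * w 0 1))
  * c r (y 0 2) + c r (y 0 0) * c r (y 0 1) * (c' r (y 0 2) * w 0 2).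

Let is_derive_c r i y w : is_derive y w (fun y => c r (y 0 i)) (c' r (y 0 i) * w 0 i).
Proof.
have h := is_derive_scale r^-1 (is_derive_coord i y w).
have := is_derive_sub (is_derive_cst (1 : R) y w) (is_derive_sqr h).
rewrite /c (_ : (fun y => 1 - (r^-1 * y 0 i) ^+ 2) = (fun y => 1 - (y 0 i / r) ^+ 2)).
  by move=> h'; apply: (is_derive_eq h'); rewrite /c'; ring.
by apply/funext => z; rewrite mulrC.
Qed.

Lemma is_derive_cutoff r y w : is_derive y w (cutoff r) (dcutoff r y w).
Proof. by do !apply: is_derive_mul. Qed.

Let continuous_c r i : continuous (fun y : 'rV[R]_3 => c r (y 0 i)).
Proof.
apply: continuous_sub; first exact: continuous_cst3.
have h : continuous (fun y : 'rV[R]_3 => y 0 i / r).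
  exact: continuous_mulr (@continuous_coord R i).
exact: (continuous_mul h h).
Qed.

Let continuous_c' r i : continuous (fun y : 'rV[R]_3 => c' r (y 0 i)).
Proof.
rewrite /c'; under eq_fun do rewrite -mulrN.
apply: continuous_mull; under eq_fun do rewrite -!mulrN.
apply: continuous_mulr; exact: continuous_mulr (@continuous_coord R i).
Qed.

Lemma continuous_cutoff r : continuous (cutoff r).
Proof.
rewrite /cutoff; apply: continuous_mul; last exact: continuous_c.
by apply: continuous_mul; exact: continuous_c.
Qed.

Lemma continuous_dcutoff r w : continuous (fun y => dcutoff r y w).
Proof.
have k j : continuous (fun y : 'rV[R]_3 => c' r (y 0 j) * w 0 j).
  by apply: continuous_mulr; exact: continuous_c'.
apply: continuous_add.
  apply: continuous_mul; last exact: continuous_c.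
  apply: continuous_add.
    by apply: continuous_mul; [exact: k|exact: continuous_c].
  by apply: continuous_mul; [exact: continuous_c|exact: k].
apply: continuous_mul; last exact: k.
by apply: continuous_mul; exact: continuous_c.
Qed.

Lemma cutoff_boundary r i y : 0 < r -> `|y 0 i| = r -> cutoff r y = 0.
Proof.
move=> r0 yr; have c0 : c r (y 0 i) = 0.
  by rewrite /c expr_div_n -real_normK ?num_real // yr divff ?subrr // expf_neq0 // gt_eqF.
rewrite /cutoff; move: i yr c0; apply: forall_I3 => _ ->.
- by rewrite !mul0r.
- by rewrite mulr0 mul0r.
- by rewrite mulr0.
Qed.

Let c_itv r (t : R) : 0 < r -> `|t| <= r -> 0 <= c r t <= 1.
Proof.
move=> r0 tr; rewrite /c subr_ge0 lerBlDr lerDl sqr_ge0 andbT.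
by rewrite -real_normK ?num_real // expr_le1 // normf_div (gtr0_norm r0) ler_pdivrMr // mul1r.
Qed.

Lemma cutoff_itv r y : 0 < r -> (forall i, `|y 0 i| <= r) -> 0 <= cutoff r y <= 1.
Proof.
move=> r0 hy.
have /andP[a0 a1] := c_itv r0 (hy 0).
have /andP[b0 b1] := c_itv r0 (hy 1).
have /andP[d0 d1] := c_itv r0 (hy 2).
by rewrite /cutoff !mulr_ge0 //= !mulr_ile1 // mulr_ge0.
Qed.

(** The decay 1/r is what compensates a field of linear growth. *)
Lemma dcutoff_e_le r y i : 0 < r -> (forall j, `|y 0 j| <= r) ->
  `|dcutoff r y 'e_i| <= 2 / r.
Proof.
move=> r0 hy.
have hc j : `|c r (y 0 j)| <= 1.
  by have /andP[c0 c1] := c_itv r0 (hy j); rewrite ger0_norm.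
have hc' j : `|c' r (y 0 j)| <= 2 / r.
  have tr : `|y 0 j / r| <= 1.
    by rewrite normf_div (gtr0_norm r0) ler_pdivrMr // mul1r.
  rewrite /c' normrN normrM [X in _ * X]normrM (@ger0_norm _ 2) //.
  rewrite (@gtr0_norm _ r^-1) ?invr_gt0 // ler_pM2l //.
  by rewrite ler_piMl // invr_ge0 ltW.
have h3 (a b d : R) : `|a| <= 2 / r -> `|b| <= 1 -> `|d| <= 1 ->
    `|a * b * d| <= 2 / r.
  move=> ha hb hd; rewrite !normrM -[leRHS]mulr1 ler_pM // ?mulr_ge0 //.
  by rewrite -[leRHS]mulr1 ler_pM.
rewrite /dcutoff; move: i; apply: forall_I3; rewrite !coord_e /=
  ?(mulr0, mulr1, mul0r, addr0, add0r).
- exact: h3.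
- by rewrite [X in X * _]mulrC; exact: h3.
- by rewrite mulrC mulrA; exact: h3.
Qed.

Lemma natr_cvgy_div (t : R) : t / n.+1%:R @[n --> \oo] --> (0 : R).
Proof.
rewrite -[X in _ --> X](mulr0 t).
by apply: cvgM; [exact: cvg_cst|exact: cvg_harmonic].
Qed.

Let c_cvg (t : R) : c n.+1%:R t @[n --> \oo] --> (1 : R).
Proof.
have h := cvgB (cvg_cst (1 : R)) (cvgM (natr_cvgy_div t) (natr_cvgy_div t)).
by rewrite mulr0 subr0 in h; exact: h.
Qed.

Let c'_cvg (t : R) : c' n.+1%:R t @[n --> \oo] --> (0 : R).
Proof.
have h := cvgN (cvgM (cvg_cst (2 : R)) (cvgM (natr_cvgy_div t) (@cvg_harmonic R))).
by rewrite !mulr0 oppr0 in h; exact: h.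
Qed.

Lemma cutoff_cvg y : cutoff n.+1%:R y @[n --> \oo] --> (1 : R).
Proof.
have h := cvgM (cvgM (c_cvg (y 0 0)) (c_cvg (y 0 1))) (c_cvg (y 0 2)).
by rewrite !mulr1 in h; exact: h.
Qed.

Lemma dcutoff_cvg y w : dcutoff n.+1%:R y w @[n --> \oo] --> (0 : R).
Proof.
have k j : c' n.+1%:R (y 0 j) * w 0 j @[n --> \oo] --> (0 : R).
  by have h := cvgM (c'_cvg (y 0 j)) (cvg_cst (w 0 j)); rewrite mul0r in h; exact: h.
have h := cvgD (cvgM (cvgD (cvgM (k 0) (c_cvg (y 0 1)))
  (cvgM (c_cvg (y 0 0)) (k 1))) (c_cvg (y 0 2)))
  (cvgM (cvgM (c_cvg (y 0 0)) (c_cvg (y 0 1))) (k 2)).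
by rewrite !(mul0r, mulr0, addr0) in h; exact: h.
Qed.

End Cutoff.

(** * A Liouville theorem for transport by an expanding field *)

Section TransportLiouville.
Context {R : realType}.
Local Notation RB := (measurableTypeR R).
Local Notation leb := (@lebesgue_measure R).
Local Notation leb3 := (leb2 \x leb)%E.
Context (h v dv : 'I_3 -> 'rV[R]_3 -> R) (dh : 'I_3 -> 'I_3 -> 'rV[R]_3 -> R)
  (lam C C1 : R).
Hypothesis h_deriv : forall i j y, is_derive y 'e_i (h j) (dh i j y).
Hypothesis v_deriv : forall i y, is_derive y 'e_i (v i) (dv i y).
Hypothesis h_cont : forall j, continuous (h j).
Hypothesis dh_cont : forall i j, continuous (dh i j).
Hypothesis v_cont : forall i, continuous (v i).
Hypothesis dv_cont : forall i, continuous (dv i).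
Hypothesis div_v : forall y, \sum_(i < 3) dv i y = 3 * lam.
Hypothesis v_growth : forall i y, `|v i y| <= C * (1 + `|y 0 i|).
(** The sum on the left is half of v . grad |h|^2. *)
Hypothesis transport : forall y,
  `|\sum_(i < 3) v i y * \sum_(j < 3) h j y * dh i j y|
    <= C1 * \sum_(j < 3) h j y ^+ 2.
Hypotheses (lam0 : 0 < lam) (C0 : 0 <= C) (C10 : 0 <= C1).

Let s y := \sum_(j < 3) h j y ^+ 2.
Let hh i y := \sum_(j < 3) h j y * dh i j y.

Let s_ge0 y : 0 <= s y.
Proof. by apply: sumr_ge0 => j _; exact: sqr_ge0. Qed.

Let s_cont : continuous s.
Proof. by apply: continuous_sum3 => j; apply: continuous_mul; exact: h_cont. Qed.

Let hh_cont i : continuous (hh i).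
Proof.
apply: continuous_sum3 => j.
by apply: continuous_mul; [exact: h_cont|exact: dh_cont].
Qed.

Let s_deriv i y : is_derive y 'e_i s (2 * hh i y).
Proof.
have k := is_derive_sum3 (fun j => is_derive_sqr (h_deriv i j y)).
by apply: (is_derive_eq k); rewrite mulr_sumr.
Qed.

(* The divergence of the field [cutoff r * v]. *)
Let W r y := \sum_(i < 3) v i y * dcutoff r y 'e_i + 3 * lam * cutoff r y.

Let W_cont r : continuous (W r).
Proof.
apply: continuous_add.
  apply: continuous_sum3 => i; apply: continuous_mul; first exact: v_cont.
  exact: continuous_dcutoff.
by apply: continuous_mull; exact: continuous_cutoff.
Qed.

Section Exponent.
Context (q : R).
Hypotheses (q0 : 0 < q) (q1 : q <= 1).
Hypothesis s_int : leb3.-integrable setT (fun z => (s (pt z) `^ q)%:E).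

Section Regularized.
Context (e r : R).
Hypotheses (e0 : 0 < e) (r0 : 0 < r).

Let se y : 0 < s y + e. Proof. by rewrite ltr_wpDl. Qed.

Let G y := regpow q e (s y).
Let dG i y := q * (s y + e) `^ (q - 1) * (2 * hh i y).

Let G_deriv i y : is_derive y 'e_i G (dG i y).
Proof. exact: is_derive_comp1 (is_derive_regpow q (se y)) (s_deriv i y). Qed.

Let pow_cont p : continuous (fun y => (s y + e) `^ p).
Proof.
move=> y; have cp : {for s y + e, continuous (fun t : R => t `^ p)}.
  apply: differentiable_continuous; apply/derivable1_diffP.
  by apply: derivable_powR; rewrite in_itv /= se.
have k : continuous (fun y => s y + e).
  by apply: continuous_add => //; exact: continuous_cst3.
exact: (@continuous_comp _ _ _ (fun y => s y + e) (fun t => t `^ p) y (k y) cp).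
Qed.

Lemma continuous_regpow_energy : continuous G.
Proof. by apply: continuous_sub; [exact: pow_cont|exact: continuous_cst3]. Qed.

Let dG_cont i : continuous (dG i).
Proof.
apply: continuous_mul; apply: continuous_mull.
  exact: pow_cont.
exact: hh_cont.
Qed.

Let u i y := cutoff r y * (G y * v i y).
Let du i y := dcutoff r y 'e_i * (G y * v i y)
  + cutoff r y * (dG i y * v i y + G y * dv i y).

Let u_deriv i y : is_derive y 'e_i (u i) (du i y).
Proof.
apply: is_derive_mul; first exact: is_derive_cutoff.
exact: is_derive_mul (G_deriv i y) (v_deriv i y).
Qed.

Let du_cont i : continuous (du i).
Proof.
apply: continuous_add; apply: continuous_mul.
- exact: continuous_dcutoff.
- by apply: continuous_mul; [exact: continuous_regpow_energy|exact: v_cont].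
- exact: continuous_cutoff.
- apply: continuous_add; apply: continuous_mul.
  + exact: dG_cont.
  + exact: v_cont.
  + exact: continuous_regpow_energy.
  + exact: dv_cont.
Qed.

(** Product rule for the divergence of cutoff G v: the terms that do not differentiate [G] combine,
    through [div_v], into [G y * W r y]; the rest is cutoff v . grad G. *)
Let sum_du y : \sum_(i < 3) du i y =
  G y * W r y + cutoff r y * (2 * q * (s y + e) `^ (q - 1) * \sum_(i < 3) v i y * hh i y).
Proof. by rewrite /W -(div_v y) !sum_I3 /du /dG; ring. Qed.

(** Only cutoff v . grad G has to be estimated. By [transport] and [mul_powR_shift_le] it is at most
    2 q C1 s^q in absolute value, whatever [e] and [r] are. *)
Let pointwise z : box r z ->
  G (pt z) * W r (pt z) <= \sum_(i < 3) du i (pt z) + 2 * q * C1 * s (pt z) `^ q.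
Proof.
move=> [[z1 z2] z3]; rewrite sum_du -addrA lerDl.
have hb i : `|(pt z) 0 i| <= r.
  move: i; apply: forall_I3; rewrite vec3E ler_norml.
  - by move: z1; rewrite /seg /= in_itv.
  - by move: z2; rewrite /seg /= in_itv.
  - by move: z3; rewrite /seg /= in_itv.
have /andP[k0 k1] := cutoff_itv r0 hb.
move: (pt z) {hb} k0 k1 => y k0 k1.
rewrite -lerBlDl sub0r -mulrN; set E := 2 * q * _ * _.
have hE : `|E| <= 2 * q * C1 * s y `^ q.
  rewrite /E normrM [X in X * _]ger0_norm ?mulr_ge0 ?powR_ge0 ?(ltW q0) //.
  apply: le_trans (_ : 2 * q * (s y + e) `^ (q - 1) * (C1 * s y) <= _).
    apply: ler_wpM2l (transport y).
    by rewrite ?mulr_ge0 ?powR_ge0 ?(ltW q0).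
  have -> : 2 * q * (s y + e) `^ (q - 1) * (C1 * s y) =
      2 * q * C1 * (s y * (s y + e) `^ (q - 1)) by ring.
  apply: ler_wpM2l; first by rewrite !mulr_ge0 // ltW.
  exact: mul_powR_shift_le.
apply: le_trans hE; apply: le_trans (ler_norm _) _.
by rewrite normrM normrN ger0_norm // ler_piMl.
Qed.

(** The divergence integrates to 0 because [cutoff r] vanishes on the faces. The right side is free
    of [e] and [r], ready for the limit. *)
Lemma box_energy_ineq :
  (\int[leb3]_(z in box r) (G (pt z) * W r (pt z))%:E <=
   (2 * q * C1)%:E * \int[leb3]_z (s (pt z) `^ q)%:E)%E.
Proof.
have mB := measurable_box r.
have is_box : leb3.-integrable (box r) (fun z => (s (pt z) `^ q)%:E).
  exact: integrableS s_int.
have idu : leb3.-integrable (box r) (fun z => (\sum_(i < 3) du i (pt z))%:E).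
  by apply: (@box_integrable _ _ (fun y => \sum_(i < 3) du i y)); exact: continuous_sum3.
have iK := integrableZl mB (2 * q * C1) is_box.
apply: le_trans (_ : \int[leb3]_(z in box r)
    ((\sum_(i < 3) du i (pt z))%:E + (2 * q * C1)%:E * (s (pt z) `^ q)%:E) <= _)%E.
  apply: le_integral => //.
  - apply: (@box_integrable _ _ (fun y => G y * W r y)).
    by apply: continuous_mul; [exact: continuous_regpow_energy|exact: W_cont].
  - exact: integrableD.
  - by move=> z; rewrite inE => zB; rewrite -EFinM -EFinD lee_fin pointwise.
rewrite integralD //.
have -> : (\int[leb3]_(z in box r) (\sum_(i < 3) du i (pt z))%:E = 0)%E.
  under eq_integral do rewrite -sumEFin.
  rewrite (@integral_sum _ _ _ leb3 (box r) mB _ (fun i z => (du i (pt z))%:E)); last first.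
    by move=> i; exact: box_integrable.
  apply: big1 => i _; apply: (@box_divergence0 _ r i (u i)) => //.
  by move=> y yr; rewrite /u (cutoff_boundary r0 yr) mul0r.
rewrite add0e integralZl //; apply: lee_wpmul2l.
  by rewrite lee_fin !mulr_ge0 // ltW.
apply: ge0_subset_integral => //; first by have /integrableP[] := s_int.
by move=> z _; rewrite lee_fin powR_ge0.
Qed.

End Regularized.

Let W_bound r z : 1 <= r -> box r z -> `|W r (pt z)| <= 12 * C + 3 * lam.
Proof.
move=> r1 [[z1 z2] z3]; have r0 : 0 < r by exact: lt_le_trans r1.
have hb i : `|(pt z) 0 i| <= r.
  move: i; apply: forall_I3; rewrite vec3E ler_norml.
  - by move: z1; rewrite /seg /= in_itv.
  - by move: z2; rewrite /seg /= in_itv.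
  - by move: z3; rewrite /seg /= in_itv.
move: (pt z) hb => y hb.
have /andP[k0 k1] := cutoff_itv r0 hb.
(* For r >= 1, C (1 + r) (2 / r) <= 4 C; the three coordinates make up the 12 C. *)
have t i : `|v i y * dcutoff r y 'e_i| <= 4 * C.
  rewrite normrM; apply: le_trans (_ : C * (1 + r) * (2 / r) <= _).
    apply: ler_pM => //; last exact: dcutoff_e_le.
    apply: le_trans (v_growth i y) _.
    by apply: ler_wpM2l => //; rewrite lerD2l.
  have -> : C * (1 + r) * (2 / r) = C * ((1 + r) * 2 / r) by ring.
  rewrite mulrC; apply: ler_wpM2r => //.
  by rewrite ler_pdivrMr //; lra.
apply: le_trans (ler_normD _ _) _; apply: lerD.
  rewrite sum_I3; apply: le_trans (ler_normD _ _) _.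
  have := ler_normD (v 0 y * dcutoff r y 'e_0) (v 1 y * dcutoff r y 'e_1).
  by have := t 0; have := t 1; have := t 2; lra.
have l0 : 0 <= 3 * lam by rewrite mulr_ge0 // ltW.
rewrite ger0_norm ?(mulr_ge0 l0 k0) //.
by rewrite ler_piMr // mulr_ge0 // ltW.
Qed.

Let W_cvg y : W n.+1%:R y @[n --> \oo] --> 3 * lam.
Proof.
have k i : v i y * dcutoff n.+1%:R y 'e_i @[n --> \oo] --> (0 : R).
  have k := cvgM (cvg_cst (v i y)) (dcutoff_cvg y 'e_i).
  by rewrite mulr0 in k; exact: k.
have k' : 3 * lam * cutoff n.+1%:R y @[n --> \oo] --> 3 * lam.
  have k' := cvgM (cvg_cst (3 * lam)) (cutoff_cvg y).
  by rewrite mulr1 in k'; exact: k'.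
rewrite /W; under eq_fun do rewrite sum_I3.
have := cvgD (cvgD (cvgD (k 0) (k 1)) (k 2)) k'.
by rewrite !add0r; exact.
Qed.

Let near_box z : \forall n \near \oo, @box R n.+1%:R z.
Proof.
have bd (t : R) : \forall n \near \oo, t \in @seg R n.+1%:R.
  near=> n; rewrite inE /seg /= in_itv /= -ler_norml.
  apply: le_trans (ltW (archi_boundP _)) _ => //.
  by rewrite ler_nat; near: n; exists (Num.bound `|t|) => // n /= /leqW.
have h1 := bd z.1.1; have h2 := bd z.1.2; have h3 := bd z.2.
by near=> n; split; [split|]; apply: set_mem; near: n.
Unshelve. all: by end_near. Qed.

(** Both parameters go to their limits together, e = 1/(n+1) and r = n+1. [W] tends to 3 lam
    pointwise, and (12 C + 3 lam) s^q dominates by [W_bound] and [regpow_le]. *)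
Lemma energy_ineq : ((3 * lam)%:E * \int[leb3]_z (s (pt z) `^ q)%:E <=
   (2 * q * C1)%:E * \int[leb3]_z (s (pt z) `^ q)%:E)%E.
Proof.
pose F n y := regpow q n.+1%:R^-1 (s y) * W n.+1%:R y.
(* Extension by zero puts all the integrals on one fixed domain. *)
pose f n := (fun z => (F n (pt z))%:E) \_ (box n.+1%:R).
have F_cont n : continuous (F n).
  apply: continuous_mul.
    by apply: continuous_regpow_energy; rewrite invr_gt0.
  exact: W_cont.
have [ms _] := integrableP _ _ _ s_int.
have mF n : measurable_fun setT (fun z => (F n (pt z))%:E).
  by apply/measurable_EFinP; exact: continuous_measurable_vec3.
have K0 : 0 <= 12 * C + 3 * lam by rewrite addr_ge0 ?mulr_ge0 // ltW.
have e0 n : 0 < n.+1%:R^-1 :> R by rewrite invr_gt0.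
have [] := @dominated_convergence _ _ _ leb3 setT measurableT f
  (fun z => (3 * lam)%:E * (s (pt z) `^ q)%:E)%E
  (fun z => (12 * C + 3 * lam)%:E * (s (pt z) `^ q)%:E)%E.
- move=> n; have mB := @measurable_box R n.+1%:R.
  apply: (measurable_restrictT (fun z => (F n (pt z))%:E) mB).1.
  by apply: measurable_funTS; exact: mF.
- exact: measurable_funeM.
- apply: aeW => z _.
  have k := cvgM (regpow_cvg q0 (s_ge0 (pt z))) (W_cvg (pt z)).
  apply: cvg_trans (_ : (F n (pt z))%:E @[n --> \oo] --> _).
    apply: near_eq_cvg; near=> n.
    rewrite /f patchE ifT // inE; near: n; exact: near_box.
  by rewrite muleC -EFinM; apply: cvg_EFin; [exact: nearW|exact: k].
- exact: integrableZl.
- apply: aeW => z n _; rewrite /f patchE; case: ifPn => [|_].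
    rewrite inE => zB; rewrite abse_EFin -EFinM lee_fin /F normrM mulrC.
    apply: ler_pM => //; first by apply: W_bound => //; rewrite ler1n.
    by rewrite ger0_norm ?regpow_ge0 // regpow_le.
  by rewrite abse0 -EFinM lee_fin mulr_ge0 // powR_ge0.
move=> _ _; rewrite integralZl // => fcvg.
rewrite -(cvg_lim _ fcvg) //; apply: lime_le; first by apply/cvg_ex; eexists; exact: fcvg.
apply: nearW => n /=; rewrite /f -integral_mkcond.
exact: box_energy_ineq.
Unshelve. all: by end_near. Qed.

Lemma transport_power_null : 2 * q * C1 < 3 * lam -> forall j y, h j y = 0.
Proof.
move=> qC.
(* Finiteness allows the two sides of [energy_ineq] to be compared as real numbers, which forces the
   integral to be 0. *)
have Mfin : (\int[leb3]_z (s (pt z) `^ q)%:E)%E \is a fin_num.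
  exact: integrable_fin_num.
have M0 : (\int[leb3]_z (s (pt z) `^ q)%:E = 0)%E.
  have := energy_ineq.
  have : (0 <= \int[leb3]_z (s (pt z) `^ q)%:E)%E.
    by apply: integral_ge0 => z _; rewrite lee_fin powR_ge0.
  rewrite -(fineK Mfin) -!EFinM !lee_fin => a b; congr (_%:E).
  by apply/eqP; rewrite eq_le a andbT; nra.
have [ms _] := integrableP _ _ _ s_int.
have [N [mN N0 sN]] : {ae leb3, forall z, setT z -> (s (pt z) `^ q)%:E = 0%E}.
  apply/(ae_eq_integral_abs _ measurableT ms).
  rewrite -[RHS]M0; apply: eq_integral => z _.
  by rewrite gee0_abs // lee_fin powR_ge0.
move=> j y; suff sy : s y = 0.
  apply/eqP; rewrite -sqrf_eq0.
  move/eqP: sy; rewrite psumr_eq0; last by move=> i _; exact: sqr_ge0.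
  by move/allP; apply; rewrite mem_index_enum.
apply: contrapT => /eqP sy; have {sy}sy : 0 < s y by rewrite lt_def sy s_ge0.
have : \forall x \near y, 0 < s x.
  have sc : s @ y --> s y by exact: s_cont.
  by move/cvgr_gt : sc; apply.
move=> /nbhs_ballP[d /= d0 hd].
(* Balls of the sup norm are cubes: the neighbourhood of [y] on which s > 0 contains a product of
   three intervals, of measure (2d)^3 > 0, which cannot lie in the null set [N]. *)
pose J i : set RB := `]y 0 i - d, y 0 i + d[%classic.
have mJ i : measurable (J i) by exact: measurable_itv.
have lJ i : leb (J i) = (d + d)%:E.
  rewrite /J lebesgue_measure_itv /= lte_fin ifT; last lra.
  by rewrite -EFinB; congr (_%:E); lra.
have cubeN : (J 0 `*` J 1) `*` J 2 `<=` N.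
  move=> z [[z0 z1] z2]; apply: sN => /= /(_ I) [] /eqP.
  rewrite powR_eq0 (gt_eqF q0) andbT; apply/negP; rewrite gt_eqF //.
  apply: hd.
  split=> // a i; rewrite (ord1 a) /ball /= ltr_distlC.
  by move: i; apply: forall_I3; rewrite vec3E; [move: z0|move: z1|move: z2];
    rewrite /J /= in_itv.
pose Q := (J 0 `*` J 1) `*` J 2.
have : (leb3 Q <= leb3 N)%E.
  by apply: le_measure => //; rewrite inE //; do 2?apply: measurableX.
rewrite N0 /Q product_measure1E //; last exact: measurableX.
rewrite [X in (X * _)%E](_ : _ = leb (J 0%R) * leb (J 1%R))%E; last exact: product_measure1E.
have dd : (0 < (d + d)%:E)%E by rewrite lte_fin addr_gt0.
rewrite !lJ [X in (_ * X)%E](_ : _ = (d + d)%:E); last exact: lJ.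
by rewrite leNgt => /negP; apply; apply: mule_gt0 => //; exact: mule_gt0.
Qed.

End Exponent.
End TransportLiouville.

(** * Mean value arguments: C^1 functions and mixed partial derivatives *)

Section MeanValue.
Context {R : realType}.
Implicit Types (f : 'rV[R]_3 -> R) (x p v : 'rV[R]_3).

(** Writing the intermediate point as [c * t] with c in [0, 1] treats both signs of [t] and t = 0
    alike. *)
Lemma mean_value_origin (g dg : R -> R) (t : R) :
  (forall s : R, is_derive s 1 g (dg s)) ->
  exists2 c, 0 <= c <= 1 & g t - g 0 = t * dg (c * t).
Proof.
move=> hg.
have cg a b : {within `[a, b], continuous g}.
  apply: continuous_subspaceT => s.
  by apply: differentiable_continuous; apply/derivable1_diffP; have [] := hg s.
have [t0|t0] := leP 0 t.
  have [c] := MVT_segment t0 (fun s _ => hg s) (cg _ _).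
  rewrite in_itv /= => /andP[c0 ct] E.
  have [tz|tn] := eqVneq t 0.
    by exists 0; rewrite ?lexx ?ler01 // tz subrr mul0r.
  exists (c / t).
    by rewrite divr_ge0 //= ler_pdivrMr ?mul1r // lt_def tn.
  by rewrite E subr0 divfK // mulrC.
have [c] := MVT_segment (ltW t0) (fun s _ => hg s) (cg _ _).
rewrite in_itv /= => /andP[ct c0] E.
exists (c / t).
  rewrite -[c / t]mulrNN -invrN divr_ge0 ?oppr_ge0 ?(ltW t0) //=.
  by rewrite ler_pdivrMr ?oppr_gt0 // mul1r lerN2.
by rewrite divfK ?lt_eqF // -opprB E; ring.
Qed.

Lemma mean_value_dir f df v x t : (forall y, is_derive y v f (df y)) ->
  exists2 c, 0 <= c <= 1 & f (t *: v + x) - f x = t * df ((c * t) *: v + x).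
Proof.
move=> hf.
have [s|c c01 E] := @mean_value_origin (fun s => f (s *: v + x))
    (fun s => df (s *: v + x)) t.
  exact/is_derive_line.
by exists c => //; rewrite -E scale0r add0r.
Qed.

Lemma continuous_near_rV3 f x (e : R) : continuous f -> 0 < e ->
  exists2 d, 0 < d &
    forall y : 'rV[R]_3, (forall i, `|y 0 i - x 0 i| < d) -> `|f y - f x| < e.
Proof.
move=> cf e0.
have fx : f @ x --> f x by exact: cf.
have : \forall t \near x, `|f x - f t| < e by move/cvgrPdist_lt : fx; apply.
move=> /nbhs_ballP[d /= d0 hd].
exists d => // y hy; rewrite distrC; apply: hd; split => // a i.
by rewrite (ord1 a) /ball /= distrC.
Qed.

(** The path from [x] to x + t v runs parallel to the axes, with the mean value theorem on each of
    its three legs; [w k] is the intermediate point of leg [k]. *)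
Lemma telescope_dir f (df : 'I_3 -> 'rV[R]_3 -> R) v x (t : R) :
  (forall i y, is_derive y 'e_i f (df i y)) ->
  exists2 w : 'I_3 -> 'rV[R]_3,
    forall k i, `|w k 0 i - x 0 i| <= `|t * v 0 i| &
    f (t *: v + x) - f x = t * \sum_(k < 3) v 0 k * df k (w k).
Proof.
move=> hf.
pose p1 := (t * v 0 0) *: 'e_0 + x.
pose p2 := (t * v 0 1) *: 'e_1 + p1.
pose p3 := (t * v 0 2) *: 'e_2 + p2.
have [c0 /andP[a0 b0] E0] := mean_value_dir x (t * v 0 0) (hf 0).
have [c1 /andP[a1 b1] E1] := mean_value_dir p1 (t * v 0 1) (hf 1).
have [c2 /andP[a2 b2] E2] := mean_value_dir p2 (t * v 0 2) (hf 2).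
pose w := [:: (c0 * (t * v 0 0)) *: 'e_0 + x; (c1 * (t * v 0 1)) *: 'e_1 + p1;
   (c2 * (t * v 0 2)) *: 'e_2 + p2].
have hc (c a : R) : 0 <= c -> c <= 1 -> `|c * a| <= `|a|.
  by move=> h0 h1; rewrite normrM ger0_norm // ler_piMl.
exists (fun k => w`_k).
  by apply: forall_I3; apply: forall_I3; rewrite /w /p2 /p1 /= !mxE /=
    ?(mulr0, mulr1, add0r, addr0, addrK, subrr, normr0, normr_ge0) ?hc.
have -> : t *: v + x = p3.
  by apply: row3P; rewrite /p3 /p2 /p1 !mxE /= ?(mulr0, mulr1, add0r, addr0).
have -> : f p3 - f x = (f p3 - f p2) + (f p2 - f p1) + (f p1 - f x) by ring.
by rewrite E0 E1 E2 sum_I3 /w /=; ring.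
Qed.

(** Differentiating a self-similar field in time moves the argument of the profile along a ray, so
    derivatives in arbitrary directions are required. *)
Lemma is_derive_C1 f (df : 'I_3 -> 'rV[R]_3 -> R) v x :
  (forall i y, is_derive y 'e_i f (df i y)) -> (forall i, continuous (df i)) ->
  is_derive x v f (\sum_(i < 3) v 0 i * df i x).
Proof.
move=> hf cf.
suff H : h^-1 *: ((f \o shift x) (h *: v) - f x) @[h --> 0^'] -->
    \sum_(i < 3) v 0 i * df i x.
  by split; [apply/cvg_ex; eexists; exact: H|exact: (cvg_lim _ H)].
apply/cvgrPdist_lt => e e0.
(* [N] bounds every coordinate of [v] and stays positive when v = 0; each of the three legs may then
   contribute an error e / 3. *)
pose N := 1 + `|v 0 0| + `|v 0 1| + `|v 0 2|.
have N0 : 0 < N by rewrite /N !ltr_pwDl.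
have vN i : `|v 0 i| <= N.
  have := normr_ge0 (v 0 0); have := normr_ge0 (v 0 1); have := normr_ge0 (v 0 2).
  by rewrite /N; move: i; apply: forall_I3; lra.
have eN : 0 < e / (3 * N) by rewrite divr_gt0 // mulr_gt0.
have [d0 d00 h0] := continuous_near_rV3 x (cf 0) eN.
have [d1 d10 h1] := continuous_near_rV3 x (cf 1) eN.
have [d2 d20 h2] := continuous_near_rV3 x (cf 2) eN.
pose d := Num.min d0 (Num.min d1 d2).
have dp : 0 < d by rewrite /d !lt_min d00 d10 d20.
near=> t.
have tn0 : t != 0 by near: t; exact: nbhs_dnbhs_neq.
have td : `|t| < d / N.
  by near: t; apply: dnbhs0_lt; rewrite divr_gt0.
have [w wx E] := telescope_dir v x t hf.
have wd k i : `|w k 0 i - x 0 i| < d.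
  apply: le_lt_trans (wx k i) _; rewrite normrM.
  apply: le_lt_trans (_ : `|t| * N < _); first by apply: ler_wpM2l.
  by rewrite -ltr_pdivlMr.
rewrite /= E [_ *: _]mulrA mulVf // mul1r.
have k0 : `|df 0 (w 0) - df 0 x| < e / (3 * N).
  by apply: h0 => i; apply: lt_le_trans (wd 0 i) _; rewrite /d ge_min lexx.
have k1 : `|df 1 (w 1) - df 1 x| < e / (3 * N).
  by apply: h1 => i; apply: lt_le_trans (wd 1 i) _; rewrite /d !ge_min lexx orbT.
have k2 : `|df 2 (w 2) - df 2 x| < e / (3 * N).
  by apply: h2 => i; apply: lt_le_trans (wd 2 i) _; rewrite /d !ge_min lexx !orbT.
have K k : `|df k (w k) - df k x| < e / (3 * N) -> `|v 0 k * df k (w k) - v 0 k * df k x| < e / 3.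
  move=> hk; rewrite -mulrBr normrM.
  apply: le_lt_trans (_ : N * `|df k (w k) - df k x| < _); first exact: ler_wpM2r.
  by rewrite mulrC -ltr_pdivlMr // -mulrA -invfM.
rewrite distrC !sum_I3.
have {}k0 := K 0 k0; have {}k1 := K 1 k1; have {}k2 := K 2 k2.
move: k0 k1 k2; rewrite !ltr_norml; lra.
Unshelve. all: by end_near. Qed.

Lemma partial_commute f (a b ab ba : 'rV[R]_3 -> R) (i j : 'I_3) x :
  (forall y, is_derive y 'e_i f (a y)) -> (forall y, is_derive y 'e_j f (b y)) ->
  (forall y, is_derive y 'e_j a (ab y)) -> (forall y, is_derive y 'e_i b (ba y)) ->
  continuous ab -> continuous ba -> ab x = ba x.
Proof.
move=> ha hb hab hba cab cba; apply/eqP; rewrite -subr_eq0 -normr_eq0 eq_le normr_ge0.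
rewrite andbT leNgt; apply/negP => D0.
set D := `|_| in D0.
(* Near [x] each mixed derivative is within D / 2 of its value; a value common to both would give D
   < D. *)
have [d1 d10 h1] := continuous_near_rV3 x cab (divr_gt0 D0 (ltr0Sn _ 1)).
have [d2 d20 h2] := continuous_near_rV3 x cba (divr_gt0 D0 (ltr0Sn _ 1)).
(* The intermediate points are within 2 h of [x] in each coordinate (both steps add up when i = j),
   hence the 3. *)
pose h := Num.min d1 d2 / 3.
have hp : 0 < h by rewrite divr_gt0 // lt_min d10.
(* The second difference of [f] over a square of side [h] is [h ^+ 2] times
   either mixed derivative, each taken at some point near [x]. *)
have second (u u' : 'rV[R]_3 -> R) (k l : 'I_3) :
    (forall y, is_derive y 'e_k f (u y)) -> (forall y, is_derive y 'e_l u (u' y)) ->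
    exists2 w : 'rV[R]_3, forall m, `|w 0 m - x 0 m| <= 2 * h &
      f (h *: 'e_k + (h *: 'e_l + x)) - f (h *: 'e_l + x)
        - (f (h *: 'e_k + x) - f x) = h * (h * u' w).
  move=> hu hu'.
  have hdiff y : is_derive y 'e_k (fun z => f (h *: 'e_l + z) - f z)
      (u (h *: 'e_l + y) - u y).
    apply: is_derive_sub (hu y).
    apply/is_derive_line0.
    have /is_derive_line0 := hu (h *: 'e_l + y).
    rewrite (_ : (fun s => f (s *: 'e_k + (h *: 'e_l + y)))
      = (fun s => f (h *: 'e_l + (s *: 'e_k + y)))) //.
    by apply/funext => s; rewrite addrCA.
  have [c c01 E] := mean_value_dir x h hdiff.
  have [c' c01' E'] := mean_value_dir ((c * h) *: 'e_k + x) h hu'.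
  exists ((c' * h) *: 'e_l + ((c * h) *: 'e_k + x)).
    move=> m; rewrite !mxE eqxx /= addrA addrK.
    have ch (e : R) (t : bool) : 0 <= e <= 1 -> 0 <= e * h * t%:R <= h.
      move=> /andP[e0 e1]; case: t; rewrite ?mulr1 ?mulr0 ?lexx ?(ltW hp) //.
      by rewrite mulr_ge0 ?(ltW hp) //= ler_piMl // ltW.
    have /andP[u0 u1] := ch c' (m == l) c01'.
    have /andP[v0 v1] := ch c (m == k) c01.
    by rewrite ger0_norm; lra.
  by rewrite -E' -E [h *: 'e_l + (h *: 'e_k + x)]addrCA; ring.
have [w wx E] := second a ab i j ha hab.
have [w' wx' E'] := second b ba j i hb hba.
have W : ab w = ba w'.
  apply: (mulfI (lt0r_neq0 hp)); apply: (mulfI (lt0r_neq0 hp)).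
  by rewrite -E -E' [h *: 'e_j + (h *: 'e_i + x)]addrCA; ring.
have near_x (d : R) (z : 'rV[R]_3) : Num.min d1 d2 <= d -> (forall m, `|z 0 m - x 0 m| <= 2 * h) ->
    forall m, `|z 0 m - x 0 m| < d.
  move=> md hz m; apply: le_lt_trans (hz m) _; apply: lt_le_trans md.
  have : 0 < Num.min d1 d2 by rewrite lt_min d10.
  by rewrite /h; lra.
have := h1 w (near_x _ _ _ wx); rewrite ge_min lexx => /(_ isT).
have := h2 w' (near_x _ _ _ wx'); rewrite ge_min lexx orbT => /(_ isT).
rewrite W => p1 p2; suff : D < D by rewrite ltxx.
have := ler_normB (ba w' - ba x) (ba w' - ab x).
have -> : (ba w' - ba x) - (ba w' - ab x) = ab x - ba x by ring.
by rewrite -/D; lra.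
Qed.

End MeanValue.

(** * Algebra behind the identities for curl *)

Section Identities.
Context {R : realType}.

(** Here [p k i j] stands for the mixed derivative in directions k, i of the j-th component of a
    field, and [d k j] for the k-th derivative of the j-th component of its curl. *)
Lemma div_curl_identity (p : 'I_3 -> 'I_3 -> 'I_3 -> R) (d : 'I_3 -> 'I_3 -> R) :
  (forall k i j, p k i j = p i k j) ->
  (forall k, d k 0 = p k 1 2 - p k 2 1) -> (forall k, d k 1 = p k 2 0 - p k 0 2) ->
  (forall k, d k 2 = p k 0 1 - p k 1 0) -> \sum_(k < 3) d k k = 0.
Proof.
move=> pC d0 d1 d2.
rewrite sum_I3 d0 d1 d2 (pC 1 0) (pC 2 0) (pC 2 1); ring.
Qed.

(** This is curl (K x f) = K div f - f div K + (f . grad) K - (K . grad) f at a point, for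
    divergence-free f and K; [g k j] is the k-th derivative of (K x f)_j and [c] the curl. *)
Lemma curl_cross_identity (f K c : 'I_3 -> R) (df dK g : 'I_3 -> 'I_3 -> R) j :
  \sum_(k < 3) df k k = 0 -> \sum_(k < 3) dK k k = 0 ->
  (forall k, g k 0 = dK k 1 * f 2 - dK k 2 * f 1 + (K 1 * df k 2 - K 2 * df k 1)) ->
  (forall k, g k 1 = dK k 2 * f 0 - dK k 0 * f 2 + (K 2 * df k 0 - K 0 * df k 2)) ->
  (forall k, g k 2 = dK k 0 * f 1 - dK k 1 * f 0 + (K 0 * df k 1 - K 1 * df k 0)) ->
  c 0 = g 1 2 - g 2 1 -> c 1 = g 2 0 - g 0 2 -> c 2 = g 0 1 - g 1 0 ->
  c j = \sum_(i < 3) (f i * dK i j - K i * df i j).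
Proof.
rewrite !sum_I3 => hf hK g0 g1 g2 c0 c1 c2.
have f0 : df 0 0 = - df 1 1 - df 2 2 by move: hf; lra.
have K0 : dK 0 0 = - dK 1 1 - dK 2 2 by move: hK; lra.
move: j; apply: forall_I3.
- by rewrite c0 g1 g2 f0 K0; ring.
- by rewrite c1 g0 g2 f0 K0; ring.
- by rewrite c2 g0 g1 f0 K0; ring.
Qed.

End Identities.

(** * Fields of class C^2: components, curl and the nonlinear term *)

Section CkFields.
Context {R : realType}.
Implicit Types (F G : 'rV[R]_3 -> 'rV[R]_3) (x y v : 'rV[R]_3).

Lemma is_derive_comp F x v j : derivable F x v ->
  is_derive x v (fun y => F y 0 j) ('D_v F x 0 j).
Proof.
by move=> dF; split; [move/derivable_mxP: dF|rewrite derive_mx // mxE].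
Qed.

Lemma derivable_row3 F x v (d : 'I_3 -> R) :
  (forall j, is_derive x v (fun y => F y 0 j) (d j)) -> derivable F x v.
Proof. by move=> hF; apply/derivable_mxP => i j; rewrite (ord1 i); have [] := hF j. Qed.

Lemma derive_row3 F x v (d : 'I_3 -> R) j :
  (forall j, is_derive x v (fun y => F y 0 j) (d j)) -> 'D_v F x 0 j = d j.
Proof.
move=> hF; have dF := derivable_row3 hF.
exact: is_derive_uniq (is_derive_comp j dF) (hF j).
Qed.

Lemma abs_coord_le_enorm v i : `|v 0 i| <= enorm v.
Proof.
rewrite /enorm -sqrtr_sqr ler_sqrt ?sqr_ge0 //; last first.
  by apply: sumr_ge0 => j _; exact: sqr_ge0.
by rewrite (bigD1 i) //= lerDl sumr_ge0 // => j _; exact: sqr_ge0.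
Qed.

Lemma Ck_norm_lty k F :
  (Ck_norm k F < +oo)%E <-> exists M, forall (s : seq 'I_3) x,
    (size s <= k)%N -> enorm (iter_partial s F x) <= M.
Proof.
split=> [H|[M hM]]; last first.
  apply: le_lt_trans (ltry M); apply: ub_ereal_sup => _ [s [x [sk ->]]].
  by rewrite lee_fin hM.
have ub s x : (size s <= k)%N -> ((enorm (iter_partial s F x))%:E <= Ck_norm k F)%E.
  by move=> sk; apply: ereal_sup_ubound; exists s, x.
(* The value of [F] at the origin, the empty word of derivatives, keeps the supremum nonnegative. *)
have fn : Ck_norm k F \is a fin_num.
  rewrite ge0_fin_numE //; apply: le_trans (ub [::] 0 isT).
  by rewrite lee_fin sqrtr_ge0.
exists (fine (Ck_norm k F)) => s x sk.
by rewrite -lee_fin fineK // ub.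
Qed.

Lemma crossE0 x y : cross x y 0 0 = x 0 1 * y 0 2 - x 0 2 * y 0 1.
Proof. exact: vec3E0. Qed.
Lemma crossE1 x y : cross x y 0 1 = x 0 2 * y 0 0 - x 0 0 * y 0 2.
Proof. exact: vec3E1. Qed.
Lemma crossE2 x y : cross x y 0 2 = x 0 0 * y 0 1 - x 0 1 * y 0 0.
Proof. exact: vec3E2. Qed.

Lemma curlE0 F y : curl F y 0 0 = partial 1 F y 0 2 - partial 2 F y 0 1.
Proof. exact: vec3E0. Qed.
Lemma curlE1 F y : curl F y 0 1 = partial 2 F y 0 0 - partial 0 F y 0 2.
Proof. exact: vec3E1. Qed.
Lemma curlE2 F y : curl F y 0 2 = partial 0 F y 0 1 - partial 1 F y 0 0.
Proof. exact: vec3E2. Qed.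

Section TwiceDifferentiable.
Context (F : 'rV[R]_3 -> 'rV[R]_3).
Hypothesis F2 : Ck 2 F.

Let P k i := partial k (partial i F).

Lemma C2_deriv i y j : is_derive y 'e_i (fun y => F y 0 j) (partial i F y 0 j).
Proof. by apply: is_derive_comp; exact: (F2.1 [::] i y isT). Qed.

Lemma C2_deriv2 k i y j :
  is_derive y 'e_k (fun y => partial i F y 0 j) (P k i y 0 j).
Proof. by apply: is_derive_comp; exact: (F2.1 [:: i] k y isT). Qed.

Let continuous_comp0 G j : continuous G -> continuous (fun y => G y 0 j).
Proof.
move=> cG y.
exact: (@continuous_comp _ _ _ G (fun z : 'rV[R]_3 => z 0 j) y (cG y) (@continuous_coord R j _)).
Qed.

Lemma C2_cont j : continuous (fun y => F y 0 j).
Proof. by apply: continuous_comp0; exact: (F2.2 [::] isT). Qed.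

Lemma C2_cont1 i j : continuous (fun y => partial i F y 0 j).
Proof. by apply: continuous_comp0; exact: (F2.2 [:: i] isT). Qed.

Lemma C2_cont2 k i j : continuous (fun y => P k i y 0 j).
Proof. by apply: continuous_comp0; exact: (F2.2 [:: k; i] isT). Qed.

Lemma C2_commute k i y j : P k i y 0 j = P i k y 0 j.
Proof.
apply: (@partial_commute _ (fun y => F y 0 j) (fun y => partial i F y 0 j)
  (fun y => partial k F y 0 j) (fun y => P k i y 0 j) (fun y => P i k y 0 j)
  i k y).
- by move=> z; exact: C2_deriv.
- by move=> z; exact: C2_deriv.
- by move=> z; exact: C2_deriv2.
- by move=> z; exact: C2_deriv2.
- exact: C2_cont2.
- exact: C2_cont2.
Qed.

Definition dcurl k y : 'rV[R]_3 :=
  vec3 (P k 1 y 0 2 - P k 2 y 0 1) (P k 2 y 0 0 - P k 0 y 0 2)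
       (P k 0 y 0 1 - P k 1 y 0 0).

Lemma dcurlE0 k y : dcurl k y 0 0 = P k 1 y 0 2 - P k 2 y 0 1.
Proof. exact: vec3E0. Qed.
Lemma dcurlE1 k y : dcurl k y 0 1 = P k 2 y 0 0 - P k 0 y 0 2.
Proof. exact: vec3E1. Qed.
Lemma dcurlE2 k y : dcurl k y 0 2 = P k 0 y 0 1 - P k 1 y 0 0.
Proof. exact: vec3E2. Qed.

Lemma is_derive_curl k y j :
  is_derive y 'e_k (fun y => curl F y 0 j) (dcurl k y 0 j).
Proof.
have D a b := is_derive_sub (C2_deriv2 k a.1 y a.2) (C2_deriv2 k b.1 y b.2).
move: j; apply: forall_I3.
- under eq_fun do rewrite curlE0.
  by rewrite dcurlE0; exact: (D (1, 2) (2, 1)).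
- under eq_fun do rewrite curlE1.
  by rewrite dcurlE1; exact: (D (2, 0) (0, 2)).
- under eq_fun do rewrite curlE2.
  by rewrite dcurlE2; exact: (D (0, 1) (1, 0)).
Qed.

Lemma continuous_curl j : continuous (fun y => curl F y 0 j).
Proof.
by move: j; apply: forall_I3;
  [under eq_fun do rewrite curlE0|under eq_fun do rewrite curlE1
  |under eq_fun do rewrite curlE2]; apply: continuous_sub; exact: C2_cont1.
Qed.

Lemma continuous_dcurl k j : continuous (fun y => dcurl k y 0 j).
Proof.
by move: j; apply: forall_I3;
  [under eq_fun do rewrite dcurlE0|under eq_fun do rewrite dcurlE1
  |under eq_fun do rewrite dcurlE2]; apply: continuous_sub; exact: C2_cont2.
Qed.

Lemma div_curl0 y : \sum_(k < 3) dcurl k y 0 k = 0.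
Proof.
apply: (@div_curl_identity R (fun k i j => P k i y 0 j) (fun k j => dcurl k y 0 j)).
- by move=> k i j; exact: C2_commute.
- by move=> k; exact: dcurlE0.
- by move=> k; exact: dcurlE1.
- by move=> k; exact: dcurlE2.
Qed.

Lemma is_derive_cross_curl k y j :
  is_derive y 'e_k (fun y => cross (curl F y) (F y) 0 j)
    ((cross (dcurl k y) (F y) + cross (curl F y) (partial k F y)) 0 j).
Proof.
have K i := is_derive_curl k y i; have D i := C2_deriv k y i.
have M a b := is_derive_sub (is_derive_mul (K a) (D b)) (is_derive_mul (K b) (D a)).
move: j; apply: forall_I3; rewrite mxE.
- under eq_fun do rewrite crossE0.
  by rewrite !crossE0; apply: (is_derive_eq (M 1 2)); ring.
- under eq_fun do rewrite crossE1.
  by rewrite !crossE1; apply: (is_derive_eq (M 2 0)); ring.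
- under eq_fun do rewrite crossE2.
  by rewrite !crossE2; apply: (is_derive_eq (M 0 1)); ring.
Qed.

(** The nonlinear term becomes (F . grad) K - (K . grad) F with K = curl F, whose second half joins
    the dilation term to form the transport field. *)
Lemma curl_cross_curl y j : divergence F y = 0 ->
  curl (fun y => cross (curl F y) (F y)) y 0 j =
  \sum_(i < 3) (F y 0 i * dcurl i y 0 j - curl F y 0 i * partial i F y 0 j).
Proof.
have E k i : partial k (fun y => cross (curl F y) (F y)) y 0 i =
    (cross (dcurl k y) (F y) + cross (curl F y) (partial k F y)) 0 i.
  by rewrite /partial (derive_row3 _ (is_derive_cross_curl k y)).
move=> dF; apply: (@curl_cross_identity R (fun i => F y 0 i) (fun i => curl F y 0 i)
  (fun i => curl (fun y => cross (curl F y) (F y)) y 0 i)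
  (fun k i => partial k F y 0 i) (fun k i => dcurl k y 0 i)
  (fun k i => partial k (fun y => cross (curl F y) (F y)) y 0 i) j).
- exact: dF.
- exact: div_curl0.
- by move=> k; rewrite E mxE; congr (_ + _); exact: crossE0.
- by move=> k; rewrite E mxE; congr (_ + _); exact: crossE1.
- by move=> k; rewrite E mxE; congr (_ + _); exact: crossE2.
- exact: curlE0.
- exact: curlE1.
- exact: curlE2.
Qed.

End TwiceDifferentiable.
End CkFields.

(** * Vanishing of the profile *)

Section ProfileLiouville.
Context {R : realType}.

(** Each of the nine products satisfies |h_i h_j| <= (h_i^2 + h_j^2) / 2, and every square is
    collected three times. *)
Lemma quadratic_form_bound (h : 'I_3 -> R) (k : 'I_3 -> 'I_3 -> R) (m : R) :
  (forall i j, `|k i j| <= m) ->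
  `|\sum_(j < 3) h j * \sum_(i < 3) h i * k i j| <= 3 * m * \sum_(j < 3) h j ^+ 2.
Proof.
move=> km.
have t i j : `|h j * (h i * k i j)| <= m * ((h i ^+ 2 + h j ^+ 2) / 2).
  rewrite mulrA normrM mulrC; apply: ler_pM => //.
  have := sqr_ge0 (h i - h j); have := sqr_ge0 (h i + h j).
  by rewrite ler_norml; nra.
apply: le_trans (ler_norm_sum _ _ _) _.
apply: le_trans (_ : \sum_(j < 3) \sum_(i < 3) m * ((h i ^+ 2 + h j ^+ 2) / 2) <= _).
  apply: ler_sum => j _; rewrite mulr_sumr; apply: le_trans (ler_norm_sum _ _ _) _.
  by apply: ler_sum => i _; exact: t.
by rewrite !sum_I3 le_eqVlt; apply/orP; left; apply/eqP; field.
Qed.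

Lemma enorm_powR (v : 'rV[R]_3) (q : R) :
  enorm v `^ (2 * q) = (\sum_(i < 3) v 0 i ^+ 2) `^ q.
Proof.
rewrite /enorm -powR12_sqrt; last by apply: sumr_ge0 => i _; exact: sqr_ge0.
by rewrite -powRrM mulrA mulVf ?mul1r.
Qed.

(** The [j]-th profile equation is multiplied by [f j] and summed over [j]. *)
Lemma transport_identity (y f K : 'I_3 -> R) (df dK : 'I_3 -> 'I_3 -> R) (a lam : R) :
  (forall j, a * f j + lam * \sum_(i < 3) y i * df i j
     + \sum_(i < 3) (f i * dK i j - K i * df i j) = 0) ->
  \sum_(i < 3) (lam * y i - K i) * \sum_(j < 3) f j * df i j =
    - (a * \sum_(j < 3) f j ^+ 2 + \sum_(j < 3) f j * \sum_(i < 3) f i * dK i j).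
Proof.
move=> H; apply/eqP; rewrite -subr_eq0.
have H3 : \sum_(j < 3) f j * (a * f j + lam * \sum_(i < 3) y i * df i j
     + \sum_(i < 3) (f i * dK i j - K i * df i j)) = 0.
  by apply: big1 => j _; rewrite H mulr0.
by apply/eqP/(etrans _ H3); rewrite !sum_I3; ring.
Qed.

Lemma profile_liouville (F : 'rV[R]_3 -> 'rV[R]_3) (a lam p0 : R) :
  0 < lam -> 0 < p0 -> Ck_bounded 2 F -> (forall y, divergence F y = 0) ->
  (forall y j, a * F y 0 j + lam * \sum_(i < 3) y 0 i * partial i F y 0 j
     + curl (fun y => cross (curl F y) (F y)) y 0 j = 0) ->
  (forall p, 0 < p < p0 -> mem_Lp p F) -> forall y, F y = 0.
Proof.
move=> lam0 p00 [F2 /Ck_norm_lty[M hM]] divF profile FLp.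
have M0 : 0 <= M by apply: le_trans (hM [::] 0 isT); exact: sqrtr_ge0.
have b1 i y j : `|partial i F y 0 j| <= M.
  by apply: le_trans (abs_coord_le_enorm _ _) _; exact: (hM [:: i] y isT).
have b2 k i y j : `|partial k (partial i F) y 0 j| <= M.
  by apply: le_trans (abs_coord_le_enorm _ _) _; exact: (hM [:: k; i] y isT).
have bB (s t : R) : `|s| <= M -> `|t| <= M -> `|s - t| <= 2 * M.
  by move=> hs ht; apply: le_trans (ler_normB _ _) _; lra.
have bK y j : `|curl F y 0 j| <= 2 * M.
  by move: j; apply: forall_I3;
    [rewrite curlE0|rewrite curlE1|rewrite curlE2]; apply: bB; exact: b1.
have bdK k y j : `|dcurl F k y 0 j| <= 2 * M.
  by move: j; apply: forall_I3;
    [rewrite dcurlE0|rewrite dcurlE1|rewrite dcurlE2]; apply: bB; exact: b2.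
(* The entries of the derivative of curl F are differences of two second derivatives, so
   [quadratic_form_bound] applies with m = 2 M. *)
pose C1 := `|a| + 3 * (2 * M).
have C10 : 0 <= C1 by rewrite addr_ge0 // !mulr_ge0.
(* The first bound serves the power estimates, the second gives 2 q < [p0], and the third 2 q C1 <=
   2 lam < 3 lam, with C1 + 1 to keep the denominator positive. *)
pose q := Num.min 1 (Num.min (p0 / 4) (lam / (C1 + 1))).
have q0 : 0 < q by rewrite !lt_min ltr01 !divr_gt0 //= ltr_wpDl.
have q1 : q <= 1 by rewrite ge_min lexx.
have qp : q <= p0 / 4 by rewrite !ge_min lexx /= orbT.
have qC : 2 * q * C1 < 3 * lam.
  have : q * (C1 + 1) <= lam.
    by rewrite -ler_pdivlMr ?ltr_wpDl // !ge_min lexx !orbT.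
  by move: q0; nra.
have [_ Fint] := FLp (2 * q) ltac:(apply/andP; split; lra).
move=> y; apply/rowP => j; rewrite [RHS]mxE; move: j y.
apply: (@transport_power_null R (fun j y => F y 0 j)
   (fun i y => lam * y 0 i - curl F y 0 i) (fun i y => lam - dcurl F i y 0 i)
   (fun i j y => partial i F y 0 j) lam (lam + 2 * M) C1 _ _ _ _ _ _ _ _ _ _ _ _ q) => //.
- by move=> i j y; exact: C2_deriv.
- move=> i y; apply: is_derive_sub; last exact: is_derive_curl.
  apply: (is_derive_eq (is_derive_scale lam (is_derive_coord i y _))).
  by rewrite mxE !eqxx mulr1.
- by move=> j; exact: C2_cont.
- by move=> i j; exact: C2_cont1.
- move=> i; apply: continuous_sub; last exact: continuous_curl.
  by apply: continuous_mull; exact: continuous_coord.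
- move=> i; apply: continuous_sub; last exact: continuous_dcurl.
  exact: continuous_cst3.
- move=> y; rewrite sumrB (div_curl0 F2) subr0 sumr_const card_ord.
  by rewrite -[LHS]mulr_natl.
- move=> i y; apply: le_trans (ler_normB _ _) _; rewrite normrM (gtr0_norm lam0).
  apply: le_trans (lerD (lexx _) (bK y i)) _.
  by have := normr_ge0 (y 0 i); nra.
- move=> y.
  rewrite (@transport_identity (fun i => y 0 i) (fun i => F y 0 i)
    (fun i => curl F y 0 i) (fun i j => partial i F y 0 j)
    (fun i j => dcurl F i y 0 j) a lam); last first.
    by move=> j; rewrite -(curl_cross_curl F2 _ (divF y)); exact: profile.
  rewrite normrN; apply: le_trans (ler_normD _ _) _.
  rewrite /C1 mulrDl; apply: lerD.
    by rewrite normrM ler_wpM2l // ger0_norm // sumr_ge0 // => j _; exact: sqr_ge0.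
  by apply: quadratic_form_bound => i j; exact: bdK.
- by rewrite addr_ge0 ?mulr_ge0 // ltW.
- apply/integrableP; split.
    apply/measurable_EFinP; apply: (measurableT_comp (measurable_powR q)).
    apply: (@continuous_measurable_vec3 _ (fun y => \sum_(j < 3) F y 0 j ^+ 2)).
    by apply: continuous_sum3 => j; apply: continuous_mul; exact: C2_cont.
  apply: le_lt_trans Fint; rewrite le_eqVlt; apply/orP; left; apply/eqP.
  apply: eq_integral => z _; rewrite gee0_abs ?lee_fin ?powR_ge0 //.
  by rewrite enorm_powR.
Qed.

End ProfileLiouville.

(** * Dilated fields *)

Section Dilations.
Context {R : realType}.
Implicit Types (F : 'rV[R]_3 -> 'rV[R]_3) (x v : 'rV[R]_3) (c m : R).

(** Independent factors [c] and [m] let the self-similar form, its inverse and the nonlinear term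
    all be instances. *)
Definition dil c m F x : 'rV[R]_3 := c *: F (m *: x).

Lemma is_derive_dil (f : 'rV[R]_3 -> R) m x v (d : R) :
  is_derive (m *: x) v f d -> is_derive x v (fun y => f (m *: y)) (m * d).
Proof.
move=> /is_derive_line0 h; apply/is_derive_line0.
have hm : is_derive (0 : R) 1 (fun s : R => m * s) m.
  by apply: (is_derive_eq (is_deriveZ m (is_derive_id (0 : R) 1))); rewrite [_ *: _]mulr1.
have h' : is_derive (m * 0) 1 (fun s : R => f (s *: v + m *: x)) d by rewrite mulr0.
have := @is_derive1_comp R (fun s => f (s *: v + m *: x)) (fun s => m * s) 0 d m h' hm.
rewrite [d * m]mulrC (_ : _ \o _ = (fun s => f (m *: (s *: v + x)))) //.
by apply/funext => s /=; rewrite scalerDr scalerA.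
Qed.

Lemma is_derive_dil_coord c m F x v j : derivable F (m *: x) v ->
  is_derive x v (fun y => dil c m F y 0 j) (c * m * 'D_v F (m *: x) 0 j).
Proof.
move=> dF.
have h := is_derive_scale c (is_derive_dil (is_derive_comp j dF)).
under eq_fun do rewrite mxE.
by apply: (is_derive_eq h); rewrite mulrA.
Qed.

Lemma partial_dil c m F x i : derivable F (m *: x) 'e_i ->
  partial i (dil c m F) x = (c * m) *: partial i F (m *: x).
Proof.
move=> dF; apply/rowP => j; rewrite [RHS]mxE.
exact: (derive_row3 _ (fun j => is_derive_dil_coord c j dF)).
Qed.

Lemma derivable_dil c m F x v : derivable F (m *: x) v -> derivable (dil c m F) x v.
Proof. by move=> dF; exact: (derivable_row3 (fun j => is_derive_dil_coord c j dF)). Qed.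

Lemma curl_dil c m F x : (forall i, derivable F (m *: x) 'e_i) ->
  curl (dil c m F) x = (c * m) *: curl F (m *: x).
Proof.
move=> dF; have E i j : partial i (dil c m F) x 0 j = c * m * partial i F (m *: x) 0 j.
  by rewrite partial_dil // mxE.
apply: row3P; rewrite [RHS]mxE.
- apply: etrans (curlE0 _ _) (etrans _ (congr1 _ (esym (curlE0 _ _)))).
  by rewrite mulrBr; congr (_ - _); exact: E.
- apply: etrans (curlE1 _ _) (etrans _ (congr1 _ (esym (curlE1 _ _)))).
  by rewrite mulrBr; congr (_ - _); exact: E.
- apply: etrans (curlE2 _ _) (etrans _ (congr1 _ (esym (curlE2 _ _)))).
  by rewrite mulrBr; congr (_ - _); exact: E.
Qed.

Lemma divergence_dil c m F x : (forall i, derivable F (m *: x) 'e_i) ->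
  divergence (dil c m F) x = c * m * divergence F (m *: x).
Proof.
move=> dF; rewrite /divergence mulr_sumr; apply: eq_bigr => i _.
by rewrite partial_dil // mxE.
Qed.

Lemma continuous_dil c m F : continuous F -> continuous (dil c m F).
Proof.
have hm (k : R) : continuous (fun y : 'rV[R]_3 => k *: y) by exact: scaler_continuous.
move=> cF x.
have h := @continuous_comp _ _ _ (fun y : 'rV[R]_3 => m *: y) F x (hm m x) (cF _).
exact: (@continuous_comp _ _ _ _ (fun y : 'rV[R]_3 => c *: y) x h (hm c _)).
Qed.

Lemma iter_partial_dil k c m F (s : seq 'I_3) : Ck k F -> (size s <= k)%N ->
  iter_partial s (dil c m F) = dil (c * m ^+ size s) m (iter_partial s F).
Proof.
move=> [Fd _]; elim: s => [_|i s IH sk]; first by rewrite expr0 mulr1.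
rewrite /= IH ?(ltnW sk) //; apply/funext => x.
by rewrite partial_dil ?exprSr ?mulrA //; exact: Fd.
Qed.

Lemma Ck_dil k c m F : Ck k F -> Ck k (dil c m F).
Proof.
move=> Fk; split => [s i x sk|s sk].
  rewrite (iter_partial_dil c m Fk (ltnW sk)); apply: derivable_dil.
  exact: Fk.1.
by rewrite (iter_partial_dil c m Fk sk); apply: continuous_dil; exact: Fk.2.
Qed.

Lemma enormZ c x : enorm (c *: x) = `|c| * enorm x.
Proof.
rewrite /enorm -sqrtr_sqr -sqrtrM ?sqr_ge0 // mulr_sumr.
by congr Num.sqrt; apply: eq_bigr => i _; rewrite mxE exprMn.
Qed.

Lemma Ck_bounded_dil k c m F : Ck_bounded k F -> Ck_bounded k (dil c m F).
Proof.
move=> [Fk /Ck_norm_lty[M hM]]; split; first exact: Ck_dil.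
(* The base 1 + |m| is at least 1, so its [k]-th power dominates |m|^l for all l <= k, even when |m|
   < 1. *)
apply/Ck_norm_lty; exists (`|c| * (1 + `|m|) ^+ k * M) => s x sk.
rewrite (iter_partial_dil c m Fk sk) enormZ; apply: ler_pM => //.
- exact: sqrtr_ge0.
- rewrite normrM normrX ler_wpM2l //.
  apply: le_trans (_ : (1 + `|m|) ^+ size s <= _).
    by apply: lerXn2r; rewrite ?nnegrE ?addr_ge0 // lerDr.
  by apply: ler_weXn2l => //; rewrite lerDl.
- exact: hM.
Qed.

Lemma cross_scale (c d : R) (u w : 'rV[R]_3) :
  cross (c *: u) (d *: w) = (c * d) *: cross u w.
Proof.
apply: row3P; rewrite [RHS]mxE.
- apply: etrans (crossE0 _ _) (etrans _ (congr1 _ (esym (crossE0 _ _)))).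
  by rewrite !mxE; ring.
- apply: etrans (crossE1 _ _) (etrans _ (congr1 _ (esym (crossE1 _ _)))).
  by rewrite !mxE; ring.
- apply: etrans (crossE2 _ _) (etrans _ (congr1 _ (esym (crossE2 _ _)))).
  by rewrite !mxE; ring.
Qed.

End Dilations.

(** * From the time derivative on [0, T) to an ordinary derivative *)

Section TimeDerivative.
Context {R : realType}.

(** At an interior time the restriction to [0, T) is automatic nearby; the rest is the substitution
    s = h + t. *)
Lemma time_deriv_is_derive (T t : R) (f : R -> 'rV[R]_3) (l : 'rV[R]_3) :
  0 < t < T -> time_deriv T f t l ->
  forall j, is_derive t 1 (fun s => f s 0 j) (l 0 j).
Proof.
move=> /andP[t0 tT] H.
have H1 : (s - t)^-1 *: (f s - f t) @[s --> t^'] --> l.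
  move=> A /H hA.
  have near_itv : \forall s \near t^', `[0, T[%classic s.
    have : \forall s \near t, `[0, T[%classic s.
      near=> s; rewrite /= in_itv /=; apply/andP; split; near: s.
        by apply: (cvgr_ge t).
      by apply: (cvgr_lt t).
    exact: nbhs_dnbhs.
  have {}hA : \forall s \near t^', `[0, T[%classic s -> A ((s - t)^-1 *: (f s - f t)).
    exact: hA.
  by apply: filterS2 hA near_itv => s; apply.
have H2 : h^-1 *: (f (h + t) - f t) @[h --> 0^'] --> l.
  move=> A /H1 /nbhs_ballP[d /= d0 hd].
  suff : \forall h \near (0 : R)^', A (h^-1 *: (f (h + t) - f t)) by [].
  near=> h.
  have hn0 : h != 0 by near: h; exact: nbhs_dnbhs_neq.
  rewrite -[h in h^-1](addrK t); apply: hd.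
    rewrite /ball /= opprD addrA addrAC subrr sub0r normrN.
    by near: h; exact: dnbhs0_lt.
  by rewrite -subr_eq0 addrK.
move=> j.
suff H3 : h^-1 *: (((fun s => f s 0 j) \o shift t) (h *: 1) - f t 0 j)
    @[h --> 0^'] --> l 0 j.
  by split; [apply/cvg_ex; eexists; exact: H3|exact: (cvg_lim _ H3)].
have := cvg_comp _ _ H2 (@coord_continuous _ 1 3 0 j l).
apply: cvg_trans; apply: near_eq_cvg; near=> h.
by rewrite /= !mxE [h *: 1]mulr1.
Unshelve. all: by end_near. Qed.

End TimeDerivative.

(** * Time derivative of a self-similar field *)

Section SelfSimilar.
Context {R : realType}.
Implicit Types (A L T t : R) (F : 'rV[R]_3 -> 'rV[R]_3).

Lemma is_derive_powRV T t (e : R) : t < T ->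
  is_derive t 1 (fun s => ((T - s) `^ e)^-1) (e * ((T - t) `^ e)^-1 / (T - t)).
Proof.
move=> tT; have Tt : 0 < T - t by rewrite subr_gt0.
have h : is_derive t 1 (fun s : R => T - s) (-1).
  apply: (is_derive_eq (is_deriveB (is_derive_cst T t 1) (is_derive_id t 1))).
  by rewrite sub0r.
have := @is_derive1_comp R (@powR R ^~ (- e)) (fun s => T - s) t _ _
  (is_derive1_powR (- e) Tt) h.
rewrite (_ : _ \o _ = (fun s => ((T - s) `^ e)^-1)); last first.
  by apply/funext => s /=; rewrite powRN.
move=> h'; apply: (is_derive_eq h').
rewrite powRB ?(gt_eqF Tt) ?implybT // powRN powRr1 ?(ltW Tt) //.
by ring.
Qed.

(** The amplitude contributes [A]; the argument [y] moves with velocity L y / (T - t), which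
    produces the y . grad term. *)
Lemma self_similar_time_derivative A L T t F x j : t < T -> Ck 2 F ->
  let y := ((T - t) `^ L)^-1 *: x in
  is_derive t 1 (fun s => (((T - s) `^ A)^-1 *: F (((T - s) `^ L)^-1 *: x)) 0 j)
    (((T - t) `^ A)^-1 / (T - t) *
     (A * F y 0 j + L * \sum_(i < 3) y 0 i * partial i F y 0 j)).
Proof.
move=> tT F2 y.
have hA := is_derive_powRV A tT; have hL := is_derive_powRV L tT.
have hF : is_derive (((T - t) `^ L)^-1) 1 (fun r => F (r *: x) 0 j)
    (\sum_(i < 3) x 0 i * partial i F y 0 j).
  (* The ray through [x] is the line based at the origin, whence the added 0 that matches
     [is_derive_line]. *)
  have : is_derive (((T - t) `^ L)^-1 *: x + 0) x (fun y => F y 0 j)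
      (\sum_(i < 3) x 0 i * partial i F y 0 j).
    rewrite addr0; apply: (is_derive_C1 (df := fun i y => partial i F y 0 j)).
      by move=> i z; exact: C2_deriv.
    by move=> i; exact: C2_cont1.
  move/is_derive_line; under eq_fun do rewrite addr0; exact.
have hc := @is_derive1_comp R (fun r => F (r *: x) 0 j)
  (fun s => ((T - s) `^ L)^-1) t _ _ hF hL.
under eq_fun do rewrite mxE.
apply: (is_derive_eq (is_deriveM hA hc)).
have -> : \sum_(i < 3) y 0 i * partial i F y 0 j =
    ((T - t) `^ L)^-1 * \sum_(i < 3) x 0 i * partial i F y 0 j.
  by rewrite mulr_sumr; apply: eq_bigr => i _; rewrite [y 0 i]mxE mulrA.
set S := \sum_(i < 3) _.
transitivity (((T - t) `^ A)^-1 * (S * (L * ((T - t) `^ L)^-1 / (T - t)))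
  + F y 0 j * (A * ((T - t) `^ A)^-1 / (T - t))); first by [].
by ring.
Qed.

End SelfSimilar.

(** * Reduction of a self-similar solution to its profile *)

Theorem theorem1p1 (R : realType) (alpha T : R) (halpha : - 2 < alpha)
    (hT : 0 < T) :
  ~ exists (B : R -> 'rV[R]_3 -> 'rV[R]_3) (H : 'rV[R]_3 -> 'rV[R]_3),
      [/\ in_C_C2 T B,
          emhd_solution T B,
          self_similar alpha T H B,
          exists X : R -> 'rV[R]_3 -> 'rV[R]_3,
            trajectory_map T (fun t x => - current B t x) X /\
            (forall t, 0 < t < T -> C1_diffeo (X t))
        & (exists x, H x <> 0) /\
          (exists2 p0, 0 < p0 & forall p, 0 < p < p0 -> mem_Lp p H)].
Proof.
move=> [B [H [[B2 _] sol ss _ [[x0 Hx0] [p0 p00 HLp]]]]]; apply: Hx0; move: x0.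
pose t := T / 2; pose A := alpha / (alpha + 2); pose L := 1 / (alpha + 2).
have t0 : 0 < t < T by rewrite /t; lra.
have t1 : 0 <= t < T by rewrite /t; lra.
have tT : t < T by rewrite /t; lra.
have a2 : 0 < alpha + 2 by lra.
have Tt : 0 < T - t by lra.
pose r := (T - t) `^ A; pose w := (T - t) `^ L.
have r0 : 0 < r by exact: powR_gt0.
have w0 : 0 < w by exact: powR_gt0.
(* This is A + 2 L = 1, the scaling invariance of the equation: it gives the time derivative and the
   nonlinear term the same power of T - t. *)
have rww : r * w * w = T - t.
  rewrite /r /w -!powRD ?(gt_eqF Tt) ?implybT //.
  rewrite (_ : A + L + L = 1) ?powRr1 ?(ltW Tt) //.
  by rewrite /A /L; field; rewrite gt_eqF.
have BE : B t = dil r^-1 w^-1 H by apply/funext => x; exact: ss.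
(* Inverting the dilation transfers regularity, bounds and zero divergence from the time slice to
   [H]. *)
have HE : H = dil r w (B t).
  apply/funext => x; rewrite BE /dil !scalerA divff ?mulVf ?gt_eqF //.
  by rewrite !scale1r.
have H2 : Ck_bounded 2 H by rewrite HE; apply: Ck_bounded_dil; exact: B2.
have [B2t _] := B2 t t1.
apply: (@profile_liouville R H A L p0) => //.
- by rewrite divr_gt0.
- move=> y; rewrite HE divergence_dil; last by move=> i; exact: (B2t.1 [::] i _ isT).
  by have [_ ->] := sol t (w *: y) t1; rewrite mulr0.
move=> y j; pose x := w *: y.
have yE : w^-1 *: x = y by rewrite scalerA mulVf ?gt_eqF // scale1r.
have [td _] := sol t x t1.
have := time_deriv_is_derive t0 td j.
(* The self-similar form holds only for times in [0, T); the derivative at [t] sees nothing else. *)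
have Bnear : \forall s \near t, B s x 0 j =
    (((T - s) `^ A)^-1 *: H (((T - s) `^ L)^-1 *: x)) 0 j.
  near=> s; rewrite ss //; apply/andP; split; near: s.
    by apply: (cvgr_ge t) => //; case/andP: t0.
  by apply: (cvgr_lt t).
have := self_similar_time_derivative A L x j tT H2.1.
rewrite /= -/r -/w yE => d1 d2.
have [_ v1] := d1; have [_ v2] := d2.
have E : 'D_1 (fun s => B s x 0 j) t = r^-1 / (T - t) *
     (A * H y 0 j + L * \sum_(i < 3) y 0 i * partial i H y 0 j).
  by rewrite -v1; apply: near_eq_derive.
move: v2; rewrite E [RHS]mxE.
(* The current carries the factor 1/(r w) and [B] itself 1/r; the outer curl adds another 1/w. *)
have -> : (fun y => cross (current B t y) (B t y)) =
    dil (r^-1 * w^-1 * r^-1) w^-1 (fun y => cross (curl H y) (H y)).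
  apply/funext => z; rewrite /current BE curl_dil; last first.
    by move=> i; exact: (H2.1.1 [::] i _ isT).
  by rewrite cross_scale.
rewrite curl_dil; last first.
  by move=> i; apply: derivable_row3 => k; exact: (is_derive_cross_curl H2.1 i _ k).
rewrite yE mxE -rww.
set P := A * _ + _; set Q := curl _ _ _ _ => PQ.
have k0 : r^-1 * w^-1 * r^-1 * w^-1 != 0 by rewrite !mulf_neq0 ?invr_eq0 ?gt_eqF.
apply: (mulfI k0); rewrite mulr0 mulrDr.
have -> : r^-1 * w^-1 * r^-1 * w^-1 * P = r^-1 / (r * w * w) * P.
  by field; rewrite !gt_eqF.
by rewrite PQ addNr.
Unshelve. all: by end_near. Qed.
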